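(* Let $\mathfrak g$ be a symmetrizable Kac--Moody superalgebra with standard form $B$ and principal $\mathbb Z$-grading. Then $$\psi_{\mathrm{KP}}=\mathrm d\rho,$$ where $\rho\in\mathfrak h^*$ is the Weyl vector. In particular, the Kac--Peterson class of $\mathfrak g$ is trivial.
   Context: Kac--Moody superalgebras: let $I=\{1,\dots,n\}$, $A=(a_{ij})$ an $n\times n$ complex matrix normalized by $a_{ii}\in\{0,2\}$, $p:I\to\mathbb Z_2$ a parity function, and $\mathfrak h$ an even vector space of dimension $2n-\operatorname{rk}A$ with linearly independent $\alpha_i\in\mathfrak h^*$ and linearly independent $h_i\in\mathfrak h$, $\alpha_j(h_i)=a_{ij}$. Let $\bar{\mathfrak g}(A)$ be the Lie superalgebra generated by $\mathfrak h$ and $X_i,Y_i$ of parity $p(i)$ with relations $[h,X_i]=\alpha_i(h)X_i$, $[h,Y_i]=-\alpha_i(h)Y_i$, $[X_i,Y_j]=\delta_{ij}h_i$, $[\mathfrak h,\mathfrak h]=0$; the contragredient Lie superalgebra $\mathfrak g(A)$ is its quotient by the maximal ideal meeting $\mathfrak h$ trivially. It is quasisimple if every ideal $\mathfrak j$ satisfies $\mathfrak j\subset\mathfrak h$ or $\mathfrak j+\mathfrak h=\mathfrak g(A)$. $A$ is admissible if: (i) $a_{ii}=0$, $p(i)=\bar0$ imply $a_{ij}=0$ for all $j$; (ii) $a_{ii}=2$, $p(i)=\bar0$ imply $a_{ij}\in\mathbb Z_{\le0}$ for $j\ne i$ and $a_{ij}=0\Rightarrow a_{ji}=0$; (iii)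 $a_{ii}=2$, $p(i)=\bar1$ imply $a_{ij}\in2\mathbb Z_{\le0}$ for $j\neq i$ and $a_{ij}=0\Rightarrow a_{ji}=0$. $A$ is regular if $a_{ij}=0\Rightarrow a_{ji}=0$ for all $i,j$. A Kac--Moody superalgebra is a regular quasisimple admissible $\mathfrak g(A)$; it is symmetrizable if $DA$ is symmetric for some invertible diagonal $D=\operatorname{diag}(d_1,\dots,d_n)$. Then $\mathfrak g$ carries a nondegenerate even supersymmetric invariant form $B$ (standard form), normalized by $B(h,h_j)=d_j\alpha_j(h)$ for $h\in\mathfrak h$. The principal $\mathbb Z$-grading is $\deg X_i=1$, $\deg Y_i=-1$, $\deg\mathfrak h=0$. A Weyl vector is $\rho\in\mathfrak h^*$ with $\rho(h_i)=\tfrac12\alpha_i(h_i)$ for all $i$; $\rho$ is extended to $\mathfrak g$ by zero on root spaces. Kac--Peterson cocycle: put $\mathfrak g_+=\bigoplus_{i>0}\mathfrak g_i$, $\mathfrak g_-=\bigoplus_{i\le0}\mathfrak g_i$ (principal grading), with projections $\pi_\pm$. With $\operatorname{str}$ the supertrace (on finite-rank endomorphisms), $\psi_{\mathrm{KP}}(x,y)=\tfrac12\operatorname{str}(\mathrm{ad}_x\pi_-\mathrm{ad}_y\pi_+)-\tfrac12(-1)^{p(x)p(y)}\operatorname{str}(\mathrm{ad}_y\pi_-\mathrm{ad}_x\pi_+)$ for homogeneous $x,y$. $\mathrm d\rho(x,y)=\rho([x,y])$. The Kac--Peterson class is trivial if $\psi_{\mathrm{KP}}=\mathrm d\rho$ for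 some even $\rho$ of degree $0$ in the restricted dual of $\mathfrak g$.
   Formalization: The standard form is normalized by B(h,h_j) = d_j^{-1} α_j(h) instead of d_j α_j(h): with DA symmetric, the latter is in general not symmetric, e.g. for A = (2,-2; -1,2), D = diag(1,2); the conclusion does not depend on this. *)

(* Defs.v *)
From HB Require Import structures.
From mathcomp Require Import all_boot all_order all_algebra.
From mathcomp Require Import boolp classical_sets.

Set Implicit Arguments.
Unset Strict Implicit.
Unset Printing Implicit Defensive.

Import Order.TTheory GRing.Theory Num.Theory.
Local Open Scope ring_scope.

(* A Lie superalgebra is a vector space with two complementary projections
   [parpr false] and [parpr true] onto its even and odd parts; thus the
   vectors of parity [a] are the fixed points of [parpr a]. *)
HB.mixin Record Lmodule_isLieSuper (F : fieldType) V of GRing.Lmodule F V := {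
  parpr : bool -> V -> V;
  sbracket : V -> V -> V;
  parpr_linear : forall a, linear (parpr a);
  parpr_sum : forall x, parpr false x + parpr true x = x;
  parpr_idem : forall a b x, parpr a (parpr b x) = if a == b then parpr b x else 0;
  sbracket_linearl : forall y, linear (fun x => sbracket x y);
  sbracket_linearr : forall x, linear (fun y => sbracket x y);
  sbracket_parity : forall a b x y, parpr a x = x -> parpr b y = y ->
    parpr (a (+) b) (sbracket x y) = sbracket x y;
  sbracket_skew : forall a b x y, parpr a x = x -> parpr b y = y ->
    sbracket x y = - ((-1) ^+ (a && b) *: sbracket y x);
  sbracket_jacobi : forall a b x y z, parpr a x = x -> parpr b y = y ->
    sbracket x (sbracket y z) =
      sbracket (sbracket x y) z + (-1) ^+ (a && b) *: sbracket y (sbracket x z)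
}.

#[short(type="lieSuperType")]
HB.structure Definition LieSuper (F : fieldType) :=
  {V of GRing.Lmodule F V & Lmodule_isLieSuper F V}.

Section LieSuperalgebras.
Context {F : fieldType}.
Implicit Types L M : lieSuperType F.

Definition has_parity {L} (a : bool) (x : L) : Prop := parpr a x = x.

Definition graded_subspace {L} (W : {pred L}) : Prop :=
  submod_closed W /\ forall a x, x \in W -> parpr a x \in W.

Definition subsuperalgebra {L} (W : {pred L}) : Prop :=
  graded_subspace W /\ forall x y, x \in W -> y \in W -> sbracket x y \in W.

(* One-sided stability suffices, the ideals being graded. *)
Definition lie_ideal {L} (J : {pred L}) : Prop :=
  graded_subspace J /\ forall x y, y \in J -> sbracket x y \in J.

Definition lie_hom {L M} (f : L -> M) : Prop :=
  (forall a x, f (parpr a x) = parpr a (f x)) /\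
  (forall x y, f (sbracket x y) = sbracket (f x) (f y)).

(* [t] is the supertrace of the finite rank endomorphism [f]: the image of [f]
   lies in the finite-dimensional graded subspace with homogeneous basis [e],
   in which [f] has the coordinates [c], and [t] is computed in that basis. *)
Definition is_supertrace {L} (f : L -> L) (t : F) : Prop :=
  exists (m : nat) (e : 'I_m -> L) (q : 'I_m -> bool)
         (c : 'I_m -> {scalar L}),
    [/\ forall a : 'I_m -> F, \sum_k a k *: e k = 0 -> forall k, a k = 0,
        forall k, has_parity (q k) (e k),
        forall x, f x = \sum_k c k x *: e k
      & t = \sum_k (-1) ^+ q k * c k (e k)].

(* Junk value 0 when [f] is not of finite rank. *)
Definition supertrace {L} (f : L -> L) : F :=
  xget 0 [set t | is_supertrace f t]%classic.

Definition sums_of {L} (P : set L) : set L :=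
  [set y | exists2 s : seq L, (forall z, z \in s -> P z) & y = \sum_(z <- s) z]%classic.

(* The projection onto [P] along [Q], meaningful when the space is the direct
   sum of the subspaces [P] and [Q]. *)
Definition proj_along {L} (P Q : set L) (x : L) : L :=
  xget 0 [set y | P y /\ Q (x - y)]%classic.

End LieSuperalgebras.

(* The images in [L] of the generators: the Cartan space [h], the X_i, the Y_i. *)
Record generators (F : fieldType) (h : vectType F) (n : nat)
    (L : lieSuperType F) := Generators {
  cartan : {linear h -> L};
  genX : 'I_n -> L;
  genY : 'I_n -> L }.

Section Contragredient.
Context {F : fieldType} {n : nat}.
Variables (A : 'M[F]_n) (p : 'I_n -> bool).
Context {h : vectType F}.
Variables (alpha : 'I_n -> 'Hom(h, F^o)) (hv : 'I_n -> h).
Implicit Types L M : lieSuperType F.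

Definition realization : Prop :=
  [/\ \dim {:h} = (2 * n - \rank A)%N,
      free [seq alpha i | i : 'I_n],
      free [seq hv i | i : 'I_n]
    & forall i j, alpha j (hv i) = A i j].

Definition relations {L} (S : generators h n L) : Prop :=
  [/\ [/\ forall v, has_parity false (cartan S v),
          forall i, has_parity (p i) (genX S i)
        & forall i, has_parity (p i) (genY S i)],
      forall v i, sbracket (cartan S v) (genX S i) = (alpha i v : F) *: genX S i,
      forall v i, sbracket (cartan S v) (genY S i) = - ((alpha i v : F) *: genY S i),
      forall i j, sbracket (genX S i) (genY S j) =
                    if i == j then cartan S (hv i) else 0
    & forall u v, sbracket (cartan S u) (cartan S v) = 0].

Definition gens_in {L} (S : generators h n L) (W : {pred L}) : Prop :=
  [/\ forall v, cartan S v \in W, forall i, genX S i \in W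
    & forall i, genY S i \in W].

Definition maps_gens {L M} (S : generators h n L) (T : generators h n M)
    (f : L -> M) : Prop :=
  [/\ forall v, f (cartan S v) = cartan T v,
      forall i, f (genX S i) = genX T i & forall i, f (genY S i) = genY T i].

(* [L] is presented by the generators [S] and the above relations. *)
Definition is_gbar {L} (S : generators h n L) : Prop :=
  [/\ relations S,
      forall W : {pred L}, subsuperalgebra W -> gens_in S W -> forall x, x \in W
    & forall M (T : generators h n M), relations T ->
        exists2 f : {linear L -> M}, lie_hom f & maps_gens S T f].

(* [h] is regarded as a subspace of [L], so injectivity of [cartan S] is
   part of this condition. *)
Definition meets_cartan_trivially {L} (S : generators h n L) (J : {pred L}) : Prop :=
  forall v, cartan S v \in J -> v = 0.

Definition largest_trivial_ideal {L} (S : generators h n L) (J : {pred L}) : Prop :=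
  [/\ lie_ideal J, meets_cartan_trivially S J
    & forall J' : {pred L}, lie_ideal J' -> meets_cartan_trivially S J' ->
        {subset J' <= J}].

(* [L], with the generators [S], is the quotient g(A) of gbar(A). *)
Definition contragredient {L} (S : generators h n L) : Prop :=
  exists (Lbar : lieSuperType F) (Sbar : generators h n Lbar)
         (q : {linear Lbar -> L}),
    [/\ is_gbar Sbar, lie_hom q, maps_gens Sbar S q, forall y, exists x, q x = y
      & largest_trivial_ideal Sbar [pred x | q x == 0]].

Definition quasisimple {L} (S : generators h n L) : Prop :=
  forall J : {pred L}, lie_ideal J ->
    (forall x, x \in J -> exists v, x = cartan S v) \/
    (forall x, exists2 y, y \in J & exists v, x = y + cartan S v).

Definition normalized_mx : Prop := forall i, A i i = 0 \/ A i i = 2.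

Definition admissible_mx : Prop :=
  [/\ forall i, A i i = 0 -> p i = false -> forall j, A i j = 0,
      forall i, A i i = 2 -> p i = false -> forall j, j != i ->
        (exists m : nat, A i j = - m%:R) /\ (A i j = 0 -> A j i = 0)
    & forall i, A i i = 2 -> p i = true -> forall j, j != i ->
        (exists m : nat, A i j = - (2 * m)%:R) /\ (A i j = 0 -> A j i = 0)].

Definition regular_mx : Prop := forall i j, A i j = 0 -> A j i = 0.

Definition kac_moody {L} (S : generators h n L) : Prop :=
  [/\ normalized_mx, realization & contragredient S] /\
  [/\ regular_mx, quasisimple S & admissible_mx].

Definition symmetrizes (d : 'I_n -> F) : Prop :=
  (forall i, d i != 0) /\
  let D := diag_mx (\row_i d i) in (D *m A)^T = D *m A.

(* Invariance forces B(h_i, h) = B(X_i, Y_i) alpha_i(h), and the symmetry of B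
   on the h_i then says that A times diag(B(X_i, Y_i)) is symmetric; since
   here D *m A is symmetric, the scalars are the inverses of the d_i. *)
Definition standard_form {L} (S : generators h n L) (d : 'I_n -> F)
    (B : L -> L -> F) : Prop :=
  [/\ (forall y, scalar (fun x => B x y)) /\
      (forall x, scalar (fun y => B x y)),
      forall x, (forall y, B x y = 0) -> x = 0,
      forall a b x y, has_parity a x -> has_parity b y ->
        (a != b -> B x y = 0) /\ B x y = (-1) ^+ (a && b) * B y x,
      forall x y z, B (sbracket x y) z = B x (sbracket y z)
    & forall v j, B (cartan S v) (cartan S (hv j)) = (d j)^-1 * alpha j v].

Definition weyl_vector (rho : 'Hom(h, F^o)) : Prop :=
  forall i, rho (hv i) = 2^-1 * alpha i (hv i).

End Contragredient.

Section KacPeterson.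
Context {F : fieldType} {n : nat} {h : vectType F} {g : lieSuperType F}.
Variable S : generators h n g.
Implicit Types x y : g.

(* [principal k] is the component of degree k of the principal grading. *)
Inductive principal : int -> g -> Prop :=
| principal_cartan v : principal 0 (cartan S v)
| principal_X i : principal 1 (genX S i)
| principal_Y i : principal (-1) (genY S i)
| principal_lin k (a : F) x y :
    principal k x -> principal k y -> principal k (a *: x + y)
| principal_0 k : principal k 0
| principal_bracket k l x y :
    principal k x -> principal l y -> principal (k + l) (sbracket x y).

Definition g_plus : set g :=
  sums_of [set x | exists2 k : int, 0 < k & principal k x]%classic.
(* Contains the degree 0 component. *)
Definition g_minus : set g :=
  sums_of [set x | exists2 k : int, k <= 0 & principal k x]%classic.

Definition pi_plus : g -> g := proj_along g_plus g_minus.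
Definition pi_minus : g -> g := proj_along g_minus g_plus.

Definition psiKP_hom (a b : bool) x y : F :=
  2^-1 * supertrace (fun z => sbracket x (pi_minus (sbracket y (pi_plus z)))) -
  2^-1 * (-1) ^+ (a && b) *
    supertrace (fun z => sbracket y (pi_minus (sbracket x (pi_plus z)))).

Definition psiKP x y : F :=
  \sum_(a : bool) \sum_(b : bool) psiKP_hom a b (parpr a x) (parpr b y).

Definition root_vectors : set g :=
  [set x | exists2 beta : 'Hom(h, F^o), beta != 0
         & forall v, sbracket (cartan S v) x = (beta v : F) *: x]%classic.

(* The functional on [g] equal to [rho] on [h] and to 0 on the root spaces. *)
Definition extend_by_zero (rho : 'Hom(h, F^o)) x : F :=
  rho (xget 0 [set v | sums_of root_vectors (x - cartan S v)]%classic).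

Definition coboundary (f : g -> F) x y : F := f (sbracket x y).

Definition in_restricted_dual (f : g -> F) : Prop :=
  scalar f /\
  exists N : int, forall k x, N < `|k| -> principal k x -> f x = 0.

Definition even_functional (f : g -> F) : Prop :=
  forall x, has_parity true x -> f x = 0.

Definition degree0_functional (f : g -> F) : Prop :=
  forall k x, k != 0 -> principal k x -> f x = 0.

Definition KP_class_trivial : Prop :=
  exists f : g -> F,
    [/\ in_restricted_dual f, even_functional f, degree0_functional f
      & forall x y, psiKP x y = coboundary f x y].

End KacPeterson.

(* Main.v *)
(** The supertrace of P [x,y] P - [P x P, P y P], with P = pi_+ and x, y acting by
    ad, is formally that of a curvature, so psi_KP is a 2-cocycle: all the
    operators involved have finite rank because pi_- ad_y pi_+ has, g being
    spanned by the Cartan subalgebra and by iterated brackets of the X_i alone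
    or of the Y_i alone.  An element v0 of h with alpha_i(v0) = 1 for all i
    acts on the degree k component by the scalar k; hence the principal
    grading is direct, and both psi_KP and d rho vanish on components of
    non-opposite degrees.  Two cocycles that agree on the pairs (generator, -)
    agree everywhere, and by degree only psi_KP(X_i, Y_j) has to be computed;
    there the operator has rank at most one, with image spanned by X_i. *)

Require Import Defs.
From HB Require Import structures.
From mathcomp Require Import all_boot all_order all_algebra.
From mathcomp Require Import reals complex boolp classical_sets ring.

Set Implicit Arguments.
Unset Strict Implicit.
Unset Printing Implicit Defensive.

Import Order.TTheory GRing.Theory Num.Theory.
Local Open Scope ring_scope.
Local Open Scope complex_scope.

Arguments sbracket_parity {F s a b x y} _ _.
Arguments sbracket_skew {F s a b x y} _ _.
Arguments sbracket_jacobi {F s a b x y} z _ _.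

(** The supertrace, the two projections and the extension of [rho] are all defined by choice, so
    none of them can be computed before a uniqueness statement is available. For the supertrace this
    is the independence of the trace from the way an operator is written as a sum of c_k ⊗ u_k; for
    the others it is a separation of eigenvectors of the Cartan subalgebra. The factor 1/2 in
    rho(h_i) = alpha_i(h_i)/2 is the one in front of the traces in psi_KP. Since g_- contains degree
    0, ad Y_i carries X_i into g_-, and the trace for (X_i, Y_i) is alpha_i(h_i); but ad X_i
    preserves g_+, so the trace for (Y_i, X_i) is 0. *)

HB.instance Definition _ (F : fieldType) (L : lieSuperType F) (x : L) :=
  GRing.isLinear.Build F L L *:%R (sbracket x) (sbracket_linearr x).

HB.instance Definition _ (F : fieldType) (L : lieSuperType F) (a : bool) :=
  GRing.isLinear.Build F L L *:%R (parpr a : L -> L) (parpr_linear a).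

(** The projections are plain functions whose linearity is a theorem. An equality with a bundled map
    lets them be rewritten into one, after which the generic lemmas on linear maps apply. *)
Lemma linear_bundle (F : fieldType) (U V : lmodType F) (f : U -> V) :
  linear f -> exists f' : {linear U -> V}, f = f'.
Proof.
move=> lf; pose m := GRing.isLinear.Build F U V *:%R f lf.
by pose f' : {linear U -> V} := HB.pack f m; exists f'.
Qed.

Lemma scalar_bundle (F : fieldType) (U : lmodType F) (f : U -> F) :
  scalar f -> exists f' : {scalar U}, f = f'.
Proof.
move=> lf; pose m := GRing.isLinear.Build F U F *%R f lf.
by pose f' : {scalar U} := HB.pack f m; exists f'.
Qed.

(** * Finite rank endomorphisms *)

Section FiniteRank.
Context {F : fieldType} {V : lmodType F}.
Implicit Types (f : V -> V) (x : V).

(** Well-definedness of the trace on finite rank operators, by induction on the number of terms. The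
    families are arbitrary, so that two decompositions of one operator can be concatenated, one of
    them with a minus sign. *)
Lemma trace_eq0 m (c : 'I_m -> V -> F) (u : 'I_m -> V) :
  (forall k, scalar (c k)) -> (forall x, \sum_k c k x *: u k = 0) ->
  \sum_k c k (u k) = 0.
Proof.
elim: m c u => [|m IHm] c u lc cu0; first by rewrite big_ord0.
have [c0 c0E] := scalar_bundle (lc ord0).
(* If [c0 x0 = 1] then [u 0] is a combination of the other [u k], and it can
   be eliminated. *)
have [[x0 c0x0]|c0P] := pselect (exists x0, c ord0 x0 = 1); last first.
  have c00 x : c ord0 x = 0.
    apply: contrapT => /eqP cx0; apply: c0P; exists ((c ord0 x)^-1 *: x).
    by rewrite c0E linearZ /= -c0E mulVf.
  rewrite big_ord_recl c00 add0r.
  apply: (IHm (fun k => c (lift ord0 k)) (fun k => u (lift ord0 k))) => // x.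
  by have := cu0 x; rewrite big_ord_recl c00 scale0r add0r.
pose w := lift (@ord0 m).
have u0E : u ord0 = - \sum_k c (w k) x0 *: u (w k).
  by apply/eqP; rewrite -addr_eq0; have := cu0 x0;
    rewrite big_ord_recl c0x0 scale1r => ->.
have IH := IHm (fun k x => c (w k) x - c (w k) x0 * c ord0 x) (u \o w).
rewrite big_ord_recl -[RHS]IH /=.
- rewrite u0E c0E linearN linear_sum -sumrN -big_split /=.
  apply: eq_bigr => k _; rewrite linearZ /= -c0E addrC.
  by congr (_ + _); rewrite ?mulrN.
- by move=> k a x y; rewrite (lc (w k) a) (lc ord0 a) /=; ring.
move=> x; have := cu0 x; rewrite big_ord_recl u0E scalerN -scaleNr scaler_sumr.
rewrite -big_split /= => cu0x; rewrite -[RHS]cu0x; apply: eq_bigr => k _.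
by rewrite scalerA -scalerDl; congr (_ *: _); ring.
Qed.

Lemma trace_unique m1 m2 (c1 : 'I_m1 -> V -> F) (u1 : 'I_m1 -> V)
    (c2 : 'I_m2 -> V -> F) (u2 : 'I_m2 -> V) :
  (forall k, scalar (c1 k)) -> (forall k, scalar (c2 k)) ->
  (forall x, \sum_k c1 k x *: u1 k = \sum_k c2 k x *: u2 k) ->
  \sum_k c1 k (u1 k) = \sum_k c2 k (u2 k).
Proof.
move=> lc1 lc2 E; apply/eqP; rewrite -subr_eq0; apply/eqP.
pose c (k : 'I_(m1 + m2)) :=
  match split k with inl i => c1 i | inr j => fun x => - c2 j x end.
pose u (k : 'I_(m1 + m2)) := match split k with inl i => u1 i | inr j => u2 j end.
have := @trace_eq0 _ c u; rewrite big_split_ord /=.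
rewrite (eq_bigr (fun i => c1 i (u1 i))) => [|i _]; last first.
  by rewrite /c /u (unsplitK (inl i)).
rewrite (eq_bigr (fun i => - c2 i (u2 i))) => [|i _]; last first.
  by rewrite /c /u (unsplitK (inr i)).
rewrite sumrN; apply.
  move=> k; rewrite /c; case: (split k) => i //= a x y.
  by rewrite (lc2 i a) /=; ring.
move=> x; rewrite big_split_ord /=.
rewrite (eq_bigr (fun i => c1 i x *: u1 i)) => [|i _]; last first.
  by rewrite /c /u (unsplitK (inl i)).
rewrite [X in _ + X](eq_bigr (fun i => - (c2 i x *: u2 i))) => [|i _]; last first.
  by rewrite /c /u (unsplitK (inr i)) scaleNr.
by rewrite sumrN E subrr.
Qed.

Definition in_span m (u : 'I_m -> V) x := exists a : 'I_m -> F, x = \sum_k a k *: u k.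

Lemma in_span_lin m (u : 'I_m -> V) a x y :
  in_span u x -> in_span u y -> in_span u (a *: x + y).
Proof.
move=> [b ->] [c ->]; exists (fun k => a * b k + c k).
rewrite scaler_sumr -big_split /=; apply: eq_bigr => k _.
by rewrite scalerDl scalerA.
Qed.

Lemma in_span0 m (u : 'I_m -> V) : in_span u 0.
Proof. by exists (fun=> 0); rewrite big1 // => k _; rewrite scale0r. Qed.

Lemma in_spanZ m (u : 'I_m -> V) a x : in_span u x -> in_span u (a *: x).
Proof. by move=> ux; rewrite -[_ *: _]addr0; apply/in_span_lin/in_span0. Qed.

Lemma in_span_sum m (u : 'I_m -> V) I (r : seq I) (P : pred I) (v : I -> V) :
  (forall i, P i -> in_span u (v i)) -> in_span u (\sum_(i <- r | P i) v i).
Proof.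
move=> uv; apply: (big_ind (in_span u)) => //; first exact: in_span0.
by move=> x y ux uy; rewrite -[x]scale1r; apply: in_span_lin.
Qed.

Lemma in_span_gen m (u : 'I_m -> V) k : in_span u (u k).
Proof.
exists (fun j => (j == k)%:R); rewrite (bigD1 k) //= eqxx scale1r big1 ?addr0 //.
by move=> j /negPf->; rewrite scale0r.
Qed.

Lemma in_span_sub m m' (u : 'I_m -> V) (v : 'I_m' -> V) x :
  (forall k, in_span v (u k)) -> in_span u x -> in_span v x.
Proof. by move=> uv [a ->]; apply: in_span_sum => k _; apply: in_spanZ. Qed.

(** The independent family is selected from [u] by [s] rather than constructed anew, so it inherits
    homogeneity from [u], as [is_supertrace] demands. The coordinates are linear because they are
    unique. *)
Lemma in_span_coordinates m (u : 'I_m -> V) f :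
  linear f -> (forall x, in_span u (f x)) ->
  exists m' (s : 'I_m' -> 'I_m) (c : 'I_m' -> V -> F),
    [/\ forall a : 'I_m' -> F, \sum_k a k *: u (s k) = 0 -> forall k, a k = 0,
        forall k, scalar (c k)
      & forall x, f x = \sum_k c k x *: u (s k)].
Proof.
elim: m u f => [|m IHm] u f lf uf.
  exists 0, id, (fun _ _ => 0); split=> [? ? []||x] //; first by case.
  by case: (uf x) => a ->; rewrite !big_ord0.
pose w := lift (@ord0 m).
have [uw|nuw] := pselect (in_span (u \o w) (u ord0)).
  case: (IHm (u \o w) f lf) => [x|m' [s [c [uI lc fE]]]].
    apply: in_span_sub (uf x) => k; case: (unliftP ord0 k) => [j|] -> //.
    exact: (in_span_gen (u \o w)).
  by exists m', (w \o s), c.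
(* As [u ord0] is not in the span of the other vectors, its coefficient in [f x] is well defined
   modulo that span; subtracting this component leaves an operator with values in the smaller
   span. *)
have /choice[a aP] x : exists t, in_span (u \o w) (f x - t *: u ord0).
  case: (uf x) => b ->; exists (b ord0); rewrite big_ord_recl addrAC subrr add0r.
  by exists (b \o w).
have a_unique x t : in_span (u \o w) (f x - t *: u ord0) -> a x = t.
  move=> tP; apply: contrapT => /eqP; rewrite -subr_eq0 => nz; apply: nuw.
  have := in_spanZ (a x - t)^-1 (in_span_lin (-1) (aP x) tP).
  rewrite scaleN1r opprB addrA subrK -scalerBl scalerA mulVf ?scale1r //.
have la : scalar a.
  move=> b x y /=; apply: a_unique; rewrite (lf b).
  have := in_span_lin b (aP x) (aP y); congr in_span.
  by rewrite scalerBr scalerA scalerDl opprD addrACA.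
case: (IHm (u \o w) (fun x => f x - a x *: u ord0)) => [b x y||] //.
  by rewrite (lf b) (la b) /= scalerBr scalerA scalerDl opprD addrACA.
move=> m' [s [c [uI lc fE]]].
exists m'.+1, (fun k => if unlift ord0 k is Some j then w (s j) else ord0).
exists (fun k => if unlift ord0 k is Some j then c j else a); split.
- move=> b; rewrite big_ord_recl unlift_none.
  under eq_bigr do rewrite liftK.
  move=> b0; have bu0 : b ord0 = 0.
    apply: contrapT => /eqP nz; apply: nuw.
    have -> : u ord0 = (- (b ord0)^-1) *: (\sum_i b (lift ord0 i) *: u (w (s i))).
      have /eqP := b0; rewrite addr_eq0 => /eqP/(congr1 ( *:%R (b ord0)^-1)).
      by rewrite scalerA mulVf // scale1r scalerN scaleNr.
    apply/in_spanZ/in_span_sum => i _; apply/in_spanZ/(in_span_gen (u \o w)).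
  move: b0; rewrite bu0 scale0r add0r => /uI b0 k.
  by case: (unliftP ord0 k) => [j|] -> //; apply: b0.
- by move=> k; case: (unlift ord0 k).
move=> x; rewrite big_ord_recl unlift_none -[f x](subrK (a x *: u ord0)) addrC fE.
by congr (_ + _); apply: eq_bigr => k _; rewrite liftK.
Qed.

Definition finite_rank f :=
  linear f /\ exists m (u : 'I_m -> V), forall x, in_span u (f x).

Lemma finite_rank_lin a f1 f2 :
  finite_rank f1 -> finite_rank f2 -> finite_rank (fun x => a *: f1 x + f2 x).
Proof.
move=> [l1 [m1 [u1 uf1]]] [l2 [m2 [u2 uf2]]]; split.
  move=> b x y; rewrite (l1 b) (l2 b) !scalerDr !scalerA [a * b]mulrC.
  by rewrite addrACA.
pose u (k : 'I_(m1 + m2)) := match split k with inl i => u1 i | inr j => u2 j end.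
exists (m1 + m2)%N, u => x; apply: in_span_lin.
  apply: in_span_sub (uf1 x) => k.
  by have := in_span_gen u (unsplit (inl k)); rewrite {2}/u unsplitK.
apply: in_span_sub (uf2 x) => k.
by have := in_span_gen u (unsplit (inr k)); rewrite {2}/u unsplitK.
Qed.

Lemma finite_rankD f1 f2 :
  finite_rank f1 -> finite_rank f2 -> finite_rank (fun x => f1 x + f2 x).
Proof.
move=> r1 r2; have := finite_rank_lin 1 r1 r2; congr finite_rank.
by apply: funext => x; rewrite scale1r.
Qed.

Lemma finite_rank_compl (g : {linear V -> V}) f :
  finite_rank f -> finite_rank (fun x => g (f x)).
Proof.
move=> [lf [m [u uf]]]; split=> [a x y|]; first by rewrite (lf a) linearP.
exists m, (g \o u) => x; have [a ->] := uf x; exists a.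
by rewrite linear_sum; apply: eq_bigr => k _; rewrite linearZ.
Qed.

Lemma finite_rank_compr (g : {linear V -> V}) f :
  finite_rank f -> finite_rank (fun x => f (g x)).
Proof.
by move=> [lf [m [u uf]]]; split=> [a x y|]; [rewrite linearP (lf a) | exists m, u].
Qed.

End FiniteRank.

(** * The supertrace *)

Section Supertrace.
Context {F : numFieldType} {L : lieSuperType F}.
Implicit Types (f : L -> L) (x y z : L) (a b : bool).

(** The parity involution. An operator has parity [a] when it commutes with [sigma] up to the sign
    (-1)^a, and this is how parities of operators are expressed below. *)
Definition sigma x := parpr false x - parpr true x.

Lemma sigma_linear : linear sigma.
Proof. by move=> a x y; rewrite /sigma !linearP scalerDr addrACA. Qed.

HB.instance Definition _ := GRing.isLinear.Build F L L *:%R sigma sigma_linear.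

Lemma parprE a b x : has_parity a x -> parpr b x = if a == b then x else 0.
Proof. by move=> <-; rewrite parpr_idem eq_sym; case: eqP => // ->. Qed.

Lemma parpr_parity a x : has_parity a (parpr a x).
Proof. by rewrite /has_parity parpr_idem eqxx. Qed.

Lemma sigmaE a x : has_parity a x -> sigma x = (-1) ^+ a *: x.
Proof.
by move=> xa; rewrite /sigma !(parprE _ xa); case: a xa => xa;
  rewrite ?expr1 ?scaleN1r ?expr0 ?scale1r ?sub0r ?subr0.
Qed.

Lemma sigma_bracket a x y :
  has_parity a x -> sigma (sbracket x y) = (-1) ^+ a *: sbracket x (sigma y).
Proof.
move=> xa; rewrite -[in LHS](parpr_sum y) !linearD /=.
rewrite !(sigmaE (sbracket_parity xa (parpr_parity _ _))) linearN.
by case: a {xa}; rewrite /= ?expr1 ?expr0 ?scaleN1r ?scale1r ?opprK.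
Qed.

(* The supertrace of [f] is the trace of [sigma \o f], which can be computed in
   any decomposition of [f], whether or not the [u k] are independent or
   homogeneous. *)
Lemma supertraceE f m (c : 'I_m -> L -> F) (u : 'I_m -> L) :
  (forall k, scalar (c k)) -> (forall x, f x = \sum_k c k x *: u k) ->
  supertrace f = \sum_k c k (sigma (u k)).
Proof.
move=> lc fE.
have lf : linear f.
  move=> a x y; rewrite !fE scaler_sumr -big_split /=; apply: eq_bigr => k _.
  by rewrite (lc k) /= scalerDl scalerA.
pose v (k : 'I_(m + m)) :=
  match split k with inl i => parpr false (u i) | inr i => parpr true (u i) end.
pose q (k : 'I_(m + m)) := if split k is inl _ then false else true.
have vq k : has_parity (q k) (v k).
  by rewrite /q /v; case: (split k) => i; apply: parpr_parity.
have uv x : in_span v (f x).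
  rewrite fE; apply: in_span_sum => k _; apply: in_spanZ.
  rewrite -(parpr_sum (u k)) -[X in X + _]scale1r; apply: in_span_lin.
    by have := in_span_gen v (unsplit (inl k)); rewrite {2}/v unsplitK.
  by have := in_span_gen v (unsplit (inr k)); rewrite {2}/v unsplitK.
have [m' [s [c' [sI lc' fE']]]] := in_span_coordinates lf uv.
(* Existence excludes the default value 0 of [supertrace]. The chosen data need not be those built
   here; [trace_unique] compares them with the given decomposition, both being composed with
   [sigma]. *)
have strf : exists t, is_supertrace f t.
  have /choice[c'' c''E] k := scalar_bundle (lc' k).
  exists (\sum_k (-1) ^+ q (s k) * c' k (v (s k))), m', (v \o s), (q \o s), c''.
  split=> //= [x|]; first by rewrite fE'; apply: eq_bigr => k _; rewrite c''E.
  by apply: eq_bigr => k _; rewrite c''E.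
have [m1 [e [q1 [c1 [_ eq fE1 ->]]]]] : is_supertrace f (supertrace f) :=
  xgetPex 0 strf.
transitivity (\sum_k c1 k (sigma (e k))).
  by apply: eq_bigr => k _; rewrite (sigmaE (eq k)) linearZ.
apply: (@trace_unique _ _ _ _ c1 (fun k => sigma (e k)) c (fun k => sigma (u k))) => //.
  by move=> k a x y; rewrite linearP.
move=> x; transitivity (sigma (f x)).
  by rewrite fE1 linear_sum; apply: eq_bigr => k _; rewrite linearZ.
by rewrite fE linear_sum; apply: eq_bigr => k _; rewrite linearZ.
Qed.

Lemma finite_rankE f : finite_rank f ->
  exists m (c : 'I_m -> L -> F) (u : 'I_m -> L),
    (forall k, scalar (c k)) /\ forall x, f x = \sum_k c k x *: u k.
Proof.
move=> [lf [m [u uf]]]; have [m' [s [c [_ lc fE]]]] := in_span_coordinates lf uf.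
by exists m', c, (u \o s).
Qed.

Lemma supertrace_lin (a : F) f1 f2 : finite_rank f1 -> finite_rank f2 ->
  supertrace (fun x => a *: f1 x + f2 x) = a * supertrace f1 + supertrace f2.
Proof.
move=> /finite_rankE[m1 [c1 [u1 [lc1 f1E]]]] /finite_rankE[m2 [c2 [u2 [lc2 f2E]]]].
rewrite (supertraceE lc1 f1E) (supertraceE lc2 f2E).
pose u (k : 'I_(m1 + m2)) := match split k with inl i => u1 i | inr j => u2 j end.
pose c (k : 'I_(m1 + m2)) :=
  match split k with inl i => fun x => a * c1 i x | inr j => c2 j end.
rewrite (@supertraceE _ _ c u).
- rewrite big_split_ord mulr_sumr /=; congr (_ + _); apply: eq_bigr => i _.
    by rewrite /c /u (unsplitK (inl i)).
  by rewrite /c /u (unsplitK (inr i)).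
- move=> k; rewrite /c; case: (split k) => i //= b x y.
  by rewrite (lc1 i b) /=; ring.
move=> x; rewrite f1E f2E big_split_ord scaler_sumr /=.
congr (_ + _); apply: eq_bigr => i _.
  by rewrite /c /u (unsplitK (inl i)) scalerA.
by rewrite /c /u (unsplitK (inr i)).
Qed.

Lemma supertrace0 f : (forall x, f x = 0) -> supertrace f = 0.
Proof.
move=> f0; rewrite (@supertraceE _ 0 (fun _ _ => 0) (fun=> 0)) ?big_ord0 //.
by case.
Qed.

Lemma supertraceD f1 f2 : finite_rank f1 -> finite_rank f2 ->
  supertrace (fun x => f1 x + f2 x) = supertrace f1 + supertrace f2.
Proof.
move=> r1 r2; rewrite -[supertrace f1]mul1r -supertrace_lin //.
by congr supertrace; apply: funext => x; rewrite scale1r.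
Qed.

(** One decomposition of [f] serves both sides: [g] acts on its vectors in one product and on its
    functionals in the other. The sign involves only the parity of [g], since only the part of [f]
    of the same parity contributes, where the usual sign (-1)^(a a) is (-1)^a. *)
Lemma supertraceC a (g : {linear L -> L}) f :
  (forall x, sigma (g x) = (-1) ^+ a *: g (sigma x)) -> finite_rank f ->
  supertrace (fun x => g (f x)) = (-1) ^+ a * supertrace (fun x => f (g x)).
Proof.
move=> ga /finite_rankE[m [c [u [lc fE]]]].
rewrite (@supertraceE _ _ c (fun k => g (u k))) //; last first.
  by move=> x; rewrite fE linear_sum; apply: eq_bigr => k _; rewrite linearZ.
rewrite (@supertraceE (fun x => f (g x)) _ (fun k x => c k (g x)) u); last first.
- by move=> x; rewrite fE.
- by move=> k b x y; rewrite linearP (lc k).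
rewrite mulr_sumr; apply: eq_bigr => k _; have [c' ->] := scalar_bundle (lc k).
by rewrite ga linearZ.
Qed.

Lemma eq_opp0 (t : F) : t = - t -> t = 0.
Proof.
move/eqP; rewrite -subr_eq0 opprK -mulr2n -mulr_natl mulf_eq0 pnatr_eq0 /=.
by move/eqP.
Qed.

(** The operators [sigma \o f] and - [f \o sigma] coincide, and their evident decompositions have
    opposite traces. *)
Lemma supertrace_odd f : finite_rank f ->
  (forall x, sigma (f x) = - f (sigma x)) -> supertrace f = 0.
Proof.
move=> /finite_rankE[m [c [u [lc fE]]]] fodd; apply: eq_opp0.
rewrite (supertraceE lc fE).
rewrite [LHS](@trace_unique _ _ _ _ c (fun k => sigma (u k))
  (fun k x => - c k (sigma x)) u) ?sumrN //.
- by move=> k a x y; rewrite linearP (lc k) /=; ring.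
move=> x; transitivity (sigma (f x)).
  by rewrite fE linear_sum; apply: eq_bigr => k _; rewrite linearZ.
by rewrite fodd fE -sumrN; apply: eq_bigr => k _; rewrite scaleNr.
Qed.

(** Cyclicity with the even operator [D] equates the supertraces of D f and f D, so t str(f) = 0. *)
Lemma supertrace_weight (D : {linear L -> L}) f (t : F) : t != 0 ->
  finite_rank f -> (forall x, sigma (D x) = D (sigma x)) ->
  (forall x, D (f x) = t *: f x + f (D x)) -> supertrace f = 0.
Proof.
move=> t0 rf sD Df; have DfC := @supertraceC false D f _ rf.
have : supertrace (fun x => D (f x)) = t * supertrace f + supertrace (fun x => f (D x)).
  rewrite -supertrace_lin //; last exact: finite_rank_compr.
  by congr supertrace; apply: funext.
rewrite {}DfC => [|x]; rewrite expr0 ?scale1r // mul1r.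
move/eqP; rewrite -[X in X == _]add0r (inj_eq (addIr _)) eq_sym mulf_eq0 (negPf t0).
by move/eqP.
Qed.

End Supertrace.

(** * Triangular decomposition *)

Section Bracket.
Context {F : numFieldType} {L : lieSuperType F}.
Implicit Types (x y z : L) (a : F).

Lemma sbracketPl a x y z :
  sbracket (a *: x + y) z = a *: sbracket x z + sbracket y z.
Proof. exact: sbracket_linearl. Qed.

Lemma sbracketDl x y z : sbracket (x + y) z = sbracket x z + sbracket y z.
Proof. by rewrite -[x]scale1r sbracketPl !scale1r. Qed.

Lemma sbracket0l z : sbracket 0 z = 0 :> L.
Proof. by have := sbracketPl (-1) 0 0 z; rewrite scaler0 addr0 scaleN1r addNr. Qed.

Lemma sbracketZl a x z : sbracket (a *: x) z = a *: sbracket x z.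
Proof. by rewrite -[a *: x]addr0 sbracketPl sbracket0l addr0. Qed.

Lemma sbracket_even x y z : has_parity false x ->
  sbracket x (sbracket y z) = sbracket (sbracket x y) z + sbracket y (sbracket x z).
Proof.
move=> x0; rewrite -(parpr_sum y) !(linearD, sbracketDl) /=.
rewrite !(sbracket_jacobi _ x0 (parpr_parity _ _)) !expr0 !scale1r.
by rewrite addrACA.
Qed.

Lemma sbracket_even_skew x y : has_parity false x -> sbracket x y = - sbracket y x.
Proof.
move=> x0; rewrite -(parpr_sum y) linearD sbracketDl /=.
rewrite !(sbracket_skew x0 (parpr_parity _ _)) !expr0 !scale1r.
by rewrite opprD.
Qed.

Lemma parpr_bracket_even b x y : has_parity false x ->
  parpr b (sbracket x y) = sbracket x (parpr b y).
Proof.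
move=> x0; rewrite -{1}(parpr_sum y) !linearD /=.
rewrite !(parprE _ (sbracket_parity x0 (parpr_parity _ _))).
by case: b; rewrite ?addr0 ?add0r.
Qed.

Lemma sbracketA b1 b2 x y z : has_parity b1 x -> has_parity b2 y ->
  sbracket (sbracket x y) z = sbracket x (sbracket y z) -
    (-1) ^+ (b1 && b2) *: sbracket y (sbracket x z).
Proof. by move=> xb yb; rewrite (sbracket_jacobi _ xb yb) addrK. Qed.

End Bracket.

(** * Spanning by the Cartan subalgebra and iterated brackets *)

Section Words.
Context {F : numFieldType} {n : nat} {h : vectType F}.
Implicit Types (L : lieSuperType F).

(** Right-normed bracket with [i] as innermost letter; its length is [(size s).+1], hence never
    0. *)
Definition word L (G : 'I_n -> L) (i : 'I_n) (s : seq 'I_n) : L :=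
  foldr (fun j => sbracket (G j)) (G i) s.

Lemma word_parity L (G : 'I_n -> L) (p : 'I_n -> bool) i s :
  (forall j, has_parity (p j) (G j)) -> exists a, has_parity a (word G i s).
Proof.
move=> Gp; elim: s => [|j s [a IHs]]; first by exists (p i).
by exists (p j (+) a); exact: (sbracket_parity (Gp j) IHs).
Qed.

Definition swap_gens L (S : generators h n L) : generators h n L :=
  Generators (cartan S) (genY S) (genX S).

(** The symmetry of the Chevalley involution, obtained by renaming generators inside the same
    algebra. The sign of the new coroots comes from super skew-symmetry, [Y_i, X_i] = - (-1)^p(i)
    h_i. *)
Lemma swap_relations L (S : generators h n L) p alpha hv :
  relations p alpha hv S ->
  relations p (fun i => - alpha i) (fun i => - ((-1) ^+ p i *: hv i)) (swap_gens S).
Proof.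
move=> [[Hp Xp Yp] hX hY XY hh]; split=> //=.
- by move=> v i; rewrite hY opp_lfunE scaleNr.
- by move=> v i; rewrite hX opp_lfunE scaleNr opprK.
move=> i j; rewrite (sbracket_skew (Yp i) (Xp j)) XY eq_sym; case: eqP => [->|_].
  by rewrite andbb (linearN (cartan S)) (linearZ_LR (cartan S)).
by rewrite scaler0 oppr0.
Qed.

Inductive spanned L (S : generators h n L) : L -> Prop :=
| spanned_cartan v : spanned S (cartan S v)
| spanned_X i s : spanned S (word (genX S) i s)
| spanned_Y i s : spanned S (word (genY S) i s)
| spanned_lin a x y : spanned S x -> spanned S y -> spanned S (a *: x + y).

Lemma spanned_swap L (S : generators h n L) x : spanned (swap_gens S) x -> spanned S x.
Proof.
elim=> [v|i s|i s|a y z _ yS _ zS].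
- exact: spanned_cartan.
- exact: spanned_Y.
- exact: spanned_X.
exact: spanned_lin.
Qed.

Definition weight (alpha : 'I_n -> 'Hom(h, F^o)) (i : 'I_n) (s : seq 'I_n) :
  'Hom(h, F^o) := \sum_(j <- i :: s) alpha j.

Lemma weight_cons alpha i j s : weight alpha i (j :: s) = alpha j + weight alpha i s.
Proof. by rewrite /weight !big_cons addrCA. Qed.

Section Relations.
Context {L : lieSuperType F} (S : generators h n L).
Context {p : 'I_n -> bool} {alpha : 'I_n -> 'Hom(h, F^o)} {hv : 'I_n -> h}.
Context (rel : relations p alpha hv S).

Lemma cartan_parity v : has_parity false (cartan S v).
Proof. by case: rel => [[]]. Qed.

Lemma genX_parity i : has_parity (p i) (genX S i).
Proof. by case: rel => [[]]. Qed.

Lemma genY_parity i : has_parity (p i) (genY S i).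
Proof. by case: rel => [[]]. Qed.

Lemma cartan_genX v i : sbracket (cartan S v) (genX S i) = (alpha i v : F) *: genX S i.
Proof. by case: rel. Qed.

Lemma cartan_genY v i :
  sbracket (cartan S v) (genY S i) = - ((alpha i v : F) *: genY S i).
Proof. by case: rel. Qed.

Lemma genX_genY i j :
  sbracket (genX S i) (genY S j) = if i == j then cartan S (hv i) else 0.
Proof. by case: rel. Qed.

Lemma cartan_cartan u v : sbracket (cartan S u) (cartan S v) = 0.
Proof. by case: rel. Qed.

Lemma genX_cartan i v : sbracket (genX S i) (cartan S v) = - (alpha i v : F) *: genX S i.
Proof.
by rewrite -[LHS]opprK -sbracket_even_skew ?cartan_genX ?scaleNr //; apply: cartan_parity.
Qed.

Lemma cartan_word v i s :
  sbracket (cartan S v) (word (genX S) i s) = (weight alpha i s v : F) *: word (genX S) i s.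
Proof.
elim: s => [|j s IHs] /=; first by rewrite /weight big_seq1 cartan_genX.
rewrite sbracket_even; last exact: cartan_parity.
by rewrite IHs cartan_genX weight_cons sbracketZl linearZ -scalerDl add_lfunE.
Qed.

(* A half of the triangular decomposition suffices, since [swap_gens] exchanges
   the roles of the X_i and the Y_i. *)
Inductive borel : L -> Prop :=
| borel_cartan v : borel (cartan S v)
| borel_X i s : borel (word (genX S) i s)
| borel_lin a x y : borel x -> borel y -> borel (a *: x + y).

Lemma borel0 : borel 0.
Proof. by rewrite -(linear0 (cartan S)); apply: borel_cartan. Qed.

Lemma borelZ a x : borel x -> borel (a *: x).
Proof. by move=> bx; rewrite -[_ *: _]addr0; apply: borel_lin borel0. Qed.

Lemma borelD x y : borel x -> borel y -> borel (x + y).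
Proof. by move=> bx; rewrite -[x]scale1r; apply: borel_lin. Qed.

Lemma borel_genX i x : borel x -> borel (sbracket (genX S i) x).
Proof.
elim=> [v|j s|a y z _ yb _ zb]; last by rewrite linearP; apply: borel_lin.
  by rewrite genX_cartan; apply/borelZ/(borel_X _ [::]).
exact: (borel_X j (i :: s)).
Qed.

(** The Jacobi identity moves Y_i inwards. Its bracket with a letter is 0 or a multiple of some h_k,
    which acts on the remaining word by a scalar. *)
Lemma borel_genY_word i j s : borel (sbracket (genY S i) (word (genX S) j s)).
Proof.
have YX k : borel (sbracket (genY S i) (genX S k)).
  rewrite (sbracket_skew (genY_parity i) (genX_parity k)) -scaleNr.
  apply: borelZ; rewrite genX_genY; case: eqP => _; last exact: borel0.
  exact: borel_cartan.
elim: s => [|k s IHs] //=.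
rewrite (sbracket_jacobi _ (genY_parity i) (genX_parity k)).
apply: borelD; last exact/borelZ/borel_genX.
rewrite (sbracket_skew (genY_parity i) (genX_parity k)) -scaleNr sbracketZl.
apply: borelZ; rewrite genX_genY; case: eqP => _.
  by rewrite cartan_word; apply/borelZ/borel_X.
by rewrite sbracket0l; apply: borel0.
Qed.

Lemma borel_spanned x : borel x -> spanned S x.
Proof.
by elim=> *; [apply: spanned_cartan | apply: spanned_X | apply: spanned_lin].
Qed.

End Relations.

Lemma spanned_swapE L (S : generators h n L) x : spanned (swap_gens S) x <-> spanned S x.
Proof.
split; first exact: spanned_swap.
by move=> xS; apply: spanned_swap; case: S xS.
Qed.

Lemma spanned0 L (S : generators h n L) : spanned S 0.
Proof. by rewrite -(linear0 (cartan S)); apply: spanned_cartan. Qed.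

Lemma spannedZ L (S : generators h n L) a x : spanned S x -> spanned S (a *: x).
Proof. by move=> bx; rewrite -[_ *: _]addr0; apply: spanned_lin (spanned0 S). Qed.

Lemma spannedD L (S : generators h n L) x y : spanned S x -> spanned S y -> spanned S (x + y).
Proof. by move=> bx; rewrite -[x]scale1r; apply: spanned_lin. Qed.

Lemma spanned_genX L (S : generators h n L) p alpha hv i x : relations p alpha hv S ->
  spanned S x -> spanned S (sbracket (genX S i) x).
Proof.
move=> rel; elim=> [v|j s|j s|a y z _ yb _ zb].
- by rewrite (genX_cartan rel); apply/spannedZ/(spanned_X _ _ [::]).
- exact: (spanned_X S j (i :: s)).
- by apply/spanned_swap/borel_spanned; exact: (borel_genY_word (swap_relations rel)).
by rewrite linearP; apply: spanned_lin.
Qed.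

Lemma spanned_genY L (S : generators h n L) p alpha hv i x : relations p alpha hv S ->
  spanned S x -> spanned S (sbracket (genY S i) x).
Proof.
move=> /swap_relations rel /spanned_swapE xS; apply/spanned_swap.
exact: (spanned_genX i rel xS).
Qed.

Lemma spanned_adcartan L (S : generators h n L) p alpha hv v x : relations p alpha hv S ->
  spanned S x -> spanned S (sbracket (cartan S v) x).
Proof.
move=> rel; elim=> [u|j s|j s|a y z _ yb _ zb].
- by rewrite (cartan_cartan rel); apply: spanned0.
- by rewrite (cartan_word rel); apply/spannedZ/spanned_X.
- by rewrite (cartan_word (swap_relations rel)); apply/spannedZ/spanned_Y.
by rewrite linearP; apply: spanned_lin.
Qed.

Lemma spanned_parpr L (S : generators h n L) p alpha hv a x : relations p alpha hv S ->
  spanned S x -> spanned S (parpr a x).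
Proof.
move=> rel; have hom b y : spanned S y -> has_parity b y -> spanned S (parpr a y).
  by move=> yS yb; rewrite (parprE _ yb); case: eqP => // _; apply: spanned0.
elim=> [v|i s|i s|b y z _ yb _ zb]; last by rewrite linearP; apply: spanned_lin.
- by apply: hom (cartan_parity rel v); apply: spanned_cartan.
- have [b wb] := word_parity i s (genX_parity rel).
  by apply: hom wb; apply: spanned_X.
have [b wb] := word_parity i s (genY_parity rel).
by apply: hom wb; apply: spanned_Y.
Qed.

(** Generation is invoked twice: for the set of all x whose adjoint action preserves the span, which
    makes the span closed under brackets, and then for the span itself. *)
Lemma spanned_total L (S : generators h n L) p alpha hv : relations p alpha hv S ->
  (forall W : {pred L}, subsuperalgebra W -> gens_in S W -> forall x, x \in W) ->
  forall x, spanned S x.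
Proof.
move=> rel gen.
have adS x y : spanned S y -> spanned S (sbracket x y).
  have := gen [pred x | `[< forall y, spanned S y -> spanned S (sbracket x y) >]].
  move=> /(_ _ _ x) adx; apply/(asboolP (forall y, spanned S y -> _)): y.
  apply: adx; last first.
    by split=> *; apply/asboolP => y; [apply: spanned_adcartan rel |
      apply: spanned_genX rel | apply: spanned_genY rel].
  (* For [w] of parity b, the bracket of the a-component of [z] with [w] is the component of parity
     a + b of [z, w], and the span is stable under the parity projections. *)
  have par z a : (forall y, spanned S y -> spanned S (sbracket z y)) ->
      forall y, spanned S y -> spanned S (sbracket (parpr a z) y).
    move=> zS y yS; rewrite -(parpr_sum y) linearD /=.
    suff hom b w : has_parity b w -> spanned S w -> spanned S (sbracket (parpr a z) w).
      by apply: spannedD; apply: hom (parpr_parity _ _) _; apply: spanned_parpr rel yS.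
    move=> wb wS; have := spanned_parpr (a (+) b) rel (zS w wS).
    rewrite -[z in sbracket z w]parpr_sum sbracketDl linearD /=.
    rewrite (parprE _ (sbracket_parity (parpr_parity false z) wb)).
    rewrite (parprE _ (sbracket_parity (parpr_parity true z) wb)).
    by case: a b {wb} => [] [] /=; rewrite ?addr0 ?add0r.
  split; first split.
  - split=> [|a y z].
      by apply/asboolP => y _; rewrite sbracket0l; apply: spanned0.
    move=> /asboolP yS /asboolP zS; apply/asboolP => w wS.
    by rewrite sbracketPl; apply: spanned_lin; [apply: yS | apply: zS].
  - by move=> a y /asboolP yS; apply/asboolP => w; apply: par.
  move=> y z /asboolP yS /asboolP zS; apply/asboolP => w wS.
  rewrite -(parpr_sum y) -(parpr_sum z) !(sbracketDl, linearD) /=.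
  have hom a b : spanned S (sbracket (sbracket (parpr a y) (parpr b z)) w).
    rewrite (sbracketA _ (parpr_parity _ _) (parpr_parity _ _)) addrC -scaleNr.
    by apply: spanned_lin; do 2! apply: (par) => //.
  by apply: spannedD; apply: spannedD.
move=> x; have := gen [pred x | `[< spanned S x >]].
move=> /(_ _ _ x) xS; apply/asboolP; apply: xS; last first.
  by split=> *; apply/asboolP; [apply: spanned_cartan | apply: (spanned_X S _ [::]) |
    apply: (spanned_Y S _ [::])].
split; first split.
- split; first by apply/asboolP/spanned0.
  by move=> a y z /asboolP yS /asboolP zS; apply/asboolP/spanned_lin.
- by move=> a y /asboolP yS; apply/asboolP/(spanned_parpr _ rel).
by move=> y z _ /asboolP zS; apply/asboolP/adS.
Qed.

End Words.

(** * The principal grading *)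

Section SumsOf.
Context {F : numFieldType} {L : lieSuperType F}.
Implicit Types (P Q : set L) (x y : L).

Lemma sums_of_sub P x : P x -> sums_of P x.
Proof. by move=> Px; exists [:: x]; rewrite ?big_seq1 // => z; rewrite inE => /eqP->. Qed.

Lemma sums_of0 P : sums_of P 0.
Proof. by exists [::]; rewrite ?big_nil. Qed.

Lemma sums_of_lin P (a : F) x y : (forall z, P z -> P (a *: z)) ->
  sums_of P x -> sums_of P y -> sums_of P (a *: x + y).
Proof.
move=> PZ [s sP ->] [t tP ->]; exists ([seq a *: z | z <- s] ++ t).
  by move=> z; rewrite mem_cat => /orP[/mapP[w /sP Pw ->]|/tP //]; apply: PZ.
by rewrite big_cat big_map scaler_sumr.
Qed.

Lemma sums_of_map P Q (f : {linear L -> L}) x :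
  (forall z, P z -> Q (f z)) -> sums_of P x -> sums_of Q (f x).
Proof.
move=> PQ [s sP ->]; exists (map f s).
  by move=> z /mapP[w /sP /PQ Qw ->].
by rewrite linear_sum big_map.
Qed.

End SumsOf.

Section ProjAlong.
Context {F : numFieldType} {L : lieSuperType F} (P Q : set L).
Context (P_lin : forall (a : F) x y, P x -> P y -> P (a *: x + y)).
Context (Q_lin : forall (a : F) x y, Q x -> Q y -> Q (a *: x + y)).
Context (PQ0 : forall x, P x -> Q x -> x = 0).
Context (PQ_total : forall x, exists2 y, P y & Q (x - y)).

Lemma proj_alongE x y : P y -> Q (x - y) -> proj_along P Q x = y.
Proof.
move=> Py Qxy; apply: xget_unique => // z [Pz Qxz].
apply/eqP; rewrite -subr_eq0; apply/eqP; apply: PQ0.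
  by rewrite addrC -scaleN1r; apply: P_lin.
have -> : z - y = -1 *: (x - z) + (x - y) by rewrite scaleN1r opprB addrA subrK.
exact: Q_lin.
Qed.

Lemma proj_along_linear : linear (proj_along P Q).
Proof.
move=> a x y; have [x' Px' Qx'] := PQ_total x; have [y' Py' Qy'] := PQ_total y.
rewrite (proj_alongE Px' Qx') (proj_alongE Py' Qy').
apply: proj_alongE; first exact: P_lin.
by rewrite opprD addrACA -scalerBr; apply: Q_lin.
Qed.

End ProjAlong.

Section Grading.
Context {F : numFieldType} {n : nat} {h : vectType F} {L : lieSuperType F}.
Context (S : generators h n L).
Context {p : 'I_n -> bool} {alpha : 'I_n -> 'Hom(h, F^o)} {hv : 'I_n -> h}.
Context (rel : relations p alpha hv S) (tot : forall x, spanned S x).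
Context (v0 : h) (v0E : forall i, alpha i v0 = 1).
Implicit Types (x y z : L) (C : int -> Prop).

Local Notation D := (sbracket (cartan S v0)).

Lemma principal_deg k x : principal S k x -> D x = k%:~R *: x.
Proof.
elim=> {k x} [v|i|i|k a x y _ IHx _ IHy|k|k l x y _ IHx _ IHy] /=.
- by rewrite (cartan_cartan rel) scale0r.
- by rewrite (cartan_genX rel) v0E.
- by rewrite (cartan_genY rel) v0E scale1r scaleN1r.
- by rewrite linearP /= IHx IHy scalerDr !scalerA mulrC.
- by rewrite linear0 scaler0.
rewrite (sbracket_even _ _ (cartan_parity rel v0)) IHx IHy sbracketZl linearZ /=.
by rewrite intrD scalerDl.
Qed.

Lemma principalZ k (a : F) x : principal S k x -> principal S k (a *: x).
Proof. by move=> kx; rewrite -[_ *: _]addr0; apply: principal_lin (principal_0 _ _). Qed.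

Lemma principal_word k (G : 'I_n -> L) i s : (forall j, principal S k (G j)) ->
  principal S (k *+ (size s).+1) (word G i s).
Proof.
move=> kG; elim: s => [|j s IHs]; first exact: kG.
by rewrite [size _]/= mulrS; apply: principal_bracket.
Qed.

Lemma principal_wordX i s : principal S (size s).+1%:Z (word (genX S) i s).
Proof.
rewrite -[_%:Z]natz; apply: principal_word; exact: principal_X.
Qed.

Lemma principal_wordY i s : principal S (- (size s).+1%:Z) (word (genY S) i s).
Proof.
by rewrite -[_%:Z]natz -mulNrn; apply: principal_word; apply: principal_Y.
Qed.

Lemma homogeneous_ind (K : L -> Prop) :
  (forall (a : F) x y, K x -> K y -> K (a *: x + y)) ->
  (forall k a x, principal S k x -> has_parity a x -> K x) -> forall x, K x.
Proof.
move=> Klin Khom x; elim: (tot x) => [v|i s|i s|a y z _ Ky _ Kz]; last exact: Klin.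
- exact: (Khom _ _ _ (principal_cartan S v) (cartan_parity rel v)).
- have [a wa] := word_parity i s (genX_parity rel).
  exact: Khom (principal_wordX i s) wa.
have [a wa] := word_parity i s (genY_parity rel).
exact: Khom (principal_wordY i s) wa.
Qed.

Lemma homogeneous_eq (f g : {linear L -> L}) :
  (forall k a x, principal S k x -> has_parity a x -> f x = g x) -> f =1 g.
Proof.
move=> fg; apply: homogeneous_ind fg => a x y fgx fgy.
by rewrite (linearP f) (linearP g) fgx fgy.
Qed.

(** [g_plus] and [g_minus] are the cases [0 < k] and [k <= 0] by conversion, so both projections are
    handled by the same lemmas. *)
Definition graded_part C : set L :=
  sums_of [set x | exists2 k : int, C k & principal S k x]%classic.

Lemma graded_part_lin C (a : F) x y :
  graded_part C x -> graded_part C y -> graded_part C (a *: x + y).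
Proof.
by apply: sums_of_lin => z [k Ck kz]; exists k => //; apply: principalZ.
Qed.

Lemma graded_part_shift C (t : F) x :
  graded_part C x -> graded_part C (D x - t *: x).
Proof.
pose f z := D z - t *: z.
have [f' fE] : exists f' : {linear L -> L}, f = f'.
  apply: linear_bundle => a y z; rewrite /f linearP scalerDr opprD addrACA.
  by rewrite scalerBr !scalerA mulrC.
rewrite -/(f x) fE; apply: sums_of_map => z [k Ck kz]; exists k => //.
rewrite -fE /f (principal_deg kz) -scalerBl; exact: principalZ.
Qed.

(** Elimination on the number of summands: for [l] the degree of the first one, D - l removes it, so
    (D - l) x = 0 by induction. Then [x] is an eigenvector with eigenvalue [l] in [C], and the
    second hypothesis on [K] applies. *)
Lemma graded_part_eq0 C (K : L -> Prop) x :
  (forall (t : F) y, K y -> K (D y - t *: y)) ->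
  (forall k y, C k -> K y -> D y = k%:~R *: y -> y = 0) ->
  graded_part C x -> K x -> x = 0.
Proof.
move=> Kshift K0 [s]; move: {2}(size s) (erefl (size s)) => m.
elim: m s x => [|m IHm] [|y s] x //= => [_ _ ->|]; first by rewrite big_nil.
move=> [sz] sP xE Kx; have [l Cl ly] := sP y (mem_head _ _).
apply: (K0 l) => //; apply/eqP; rewrite -subr_eq0; apply/eqP.
apply: (IHm [seq D z - l%:~R *: z | z <- s]); rewrite ?size_map //.
- move=> _ /mapP[z zs ->]; have [|k Ck kz] := sP z; first by rewrite inE zs orbT.
  by exists k => //; rewrite (principal_deg kz) -scalerBl; apply: principalZ.
- rewrite xE big_cons big_map linearD /= (principal_deg ly) linear_sum /=.
  by rewrite scalerDr opprD addrACA subrr add0r sumrB -scaler_sumr.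
exact: Kshift.
Qed.

Lemma graded_part_disjoint C C' x : (forall k, C k -> C' k -> False) ->
  graded_part C x -> graded_part C' x -> x = 0.
Proof.
(* The elimination is used twice: with [K] the part of degrees in C', and then, for an eigenvector
   in that part, with [K] an eigenspace of D. In characteristic 0, distinct degrees are distinct
   eigenvalues. *)
move=> CC' xC xC'; apply: (graded_part_eq0 _ _ xC xC') => [t y|k y Ck yC' Dy].
  exact: graded_part_shift.
apply: (graded_part_eq0 (K := fun z => D z = k%:~R *: z) _ _ yC' Dy) => [t z Dz|l z Cl Dz Dz'].
  by rewrite Dz -scalerBl linearZ /= Dz !scalerA mulrC.
move: Dz'; rewrite Dz => /eqP; rewrite -subr_eq0 -scalerBl scaler_eq0 => /orP[|/eqP//].
by rewrite -intrB intr_eq0 subr_eq0 => /eqP kl; case: (CC' k); rewrite // kl.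
Qed.

Lemma graded_part_total C C' x : (forall k, C k \/ C' k) ->
  exists2 y, graded_part C y & graded_part C' (x - y).
Proof.
move=> CC'; move: x; apply: homogeneous_ind => [a x y [x' Cx C'x] [y' Cy C'y]|k a x kx _].
  exists (a *: x' + y'); first exact: graded_part_lin.
  by rewrite opprD addrACA -scalerBr; apply: graded_part_lin.
case: (CC' k) => Ck.
  exists x; first by apply: sums_of_sub; exists k.
  by rewrite subrr; apply: sums_of0.
by exists 0; [apply: sums_of0 | rewrite subr0; apply: sums_of_sub; exists k].
Qed.

Lemma pi_plus_linear : linear (pi_plus S).
Proof.
apply: proj_along_linear => [a x y|a x y|x|x].
- exact: graded_part_lin.
- exact: graded_part_lin.
- by apply: graded_part_disjoint => k; rewrite leNgt => ->.
by apply: graded_part_total => k; case: (lerP k 0); [right | left].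
Qed.

Lemma pi_minus_linear : linear (pi_minus S).
Proof.
apply: proj_along_linear => [a x y|a x y|x|x].
- exact: graded_part_lin.
- exact: graded_part_lin.
- by apply: graded_part_disjoint => k; rewrite ltNge => ->.
by apply: graded_part_total => k; case: (lerP k 0); [left | right].
Qed.

Lemma pi_plusE k x : principal S k x -> pi_plus S x = if 0 < k then x else 0.
Proof.
move=> kx; apply: proj_alongE => [a y z|a y z|y||].
- exact: graded_part_lin.
- exact: graded_part_lin.
- by apply: graded_part_disjoint => l; rewrite leNgt => ->.
- by case: ifP => k0; [apply: sums_of_sub; exists k | apply: sums_of0].
case: ifP => k0; first by rewrite subrr; apply: sums_of0.
by rewrite subr0; apply: sums_of_sub; exists k; rewrite // leNgt k0.
Qed.

Lemma pi_minusE k x : principal S k x -> pi_minus S x = if 0 < k then 0 else x.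
Proof.
move=> kx; apply: proj_alongE => [a y z|a y z|y||].
- exact: graded_part_lin.
- exact: graded_part_lin.
- by apply: graded_part_disjoint => l; rewrite ltNge => ->.
- case: ifP => k0; first exact: sums_of0.
  by apply: sums_of_sub; exists k; rewrite // leNgt k0.
case: ifP => k0; last by rewrite subrr; apply: sums_of0.
by rewrite subr0; apply: sums_of_sub; exists k.
Qed.

Lemma pi_sum x : pi_plus S x + pi_minus S x = x.
Proof.
move: x; apply: homogeneous_ind => [a x y xE yE|k a x kx _].
  by rewrite pi_plus_linear pi_minus_linear addrACA -scalerDr xE yE.
by rewrite (pi_plusE kx) (pi_minusE kx); case: ifP; rewrite ?addr0 ?add0r.
Qed.

Lemma sigma_pi_plus x : sigma (pi_plus S x) = pi_plus S (sigma x).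
Proof.
have [P PE] := linear_bundle pi_plus_linear; rewrite PE.
apply: (homogeneous_eq (f := sigma \o P) (g := P \o sigma)) => k a {}x kx xa /=.
rewrite (sigmaE xa) linearZ -PE (pi_plusE kx) /=.
by case: ifP; rewrite ?linear0 ?scaler0 // (sigmaE xa).
Qed.

Lemma sigma_pi_minus x : sigma (pi_minus S x) = pi_minus S (sigma x).
Proof.
apply: (addrI (sigma (pi_plus S x))).
by rewrite -linearD sigma_pi_plus !pi_sum.
Qed.

Lemma adv0_pi_plus x : D (pi_plus S x) = pi_plus S (D x).
Proof.
have [P PE] := linear_bundle pi_plus_linear; rewrite PE.
apply: (homogeneous_eq (f := D \o P) (g := P \o D)) => k a {}x kx xa /=.
rewrite (principal_deg kx) linearZ -PE (pi_plusE kx) /=.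
by case: ifP; rewrite ?linear0 ?scaler0 // -(principal_deg kx).
Qed.

Lemma adv0_pi_minus x : D (pi_minus S x) = pi_minus S (D x).
Proof.
apply: (addrI (D (pi_plus S x))).
by rewrite -linearD adv0_pi_plus !pi_sum.
Qed.

(** For [y] of degree l, a word in the X_i with [size s] at least |l| goes to degree l + size s + 1
    > 0 and is killed by pi_-. There are finitely many shorter words, and their images span the
    range. *)
Lemma pi_ad_pi_finite_rank y :
  finite_rank (fun z => pi_minus S (sbracket y (pi_plus S z))).
Proof.
have [P PE] := linear_bundle pi_plus_linear.
have [Q QE] := linear_bundle pi_minus_linear.
move: y; apply: homogeneous_ind => [a x y xr yr|l a y ly _].
  have := finite_rank_lin a xr yr; congr finite_rank; apply: funext => z.
  by rewrite QE sbracketPl linearP.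
split=> [a' x z|]; first by rewrite PE QE !linearP.
pose T := {k : 'I_`|l|%N & ('I_n * k.-tuple 'I_n)%type}.
pose w (t : T) := word (genX S) (tagged t).1 (tagged t).2.
exists #|{: T}|, (fun j => pi_minus S (sbracket y (w (enum_val j)))) => x.
elim: (tot x) => [v|i s|i s|b z1 z2 _ IH1 _ IH2].
- by rewrite (pi_plusE (principal_cartan S v)) QE !linear0; apply: in_span0.
- rewrite (pi_plusE (principal_wordX i s)) /=.
  have [sl|ls] := ltnP (size s) `|l|%N.
    pose t : T := Tagged (fun k : 'I_`|l|%N => ('I_n * k.-tuple 'I_n)%type)
      (i, in_tuple s : (Ordinal sl).-tuple 'I_n).
    by have := in_span_gen (fun j => pi_minus S (sbracket y (w (enum_val j))))
      (enum_rank t); rewrite enum_rankK.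
  rewrite (pi_minusE (principal_bracket ly (principal_wordX i s))) ifT.
    exact: in_span0.
  rewrite -ltrBlDl sub0r; apply: le_lt_trans (_ : `|l|%N%:Z < _).
    by rewrite abszE -normrN ler_norm.
  by rewrite ltz_nat ltnS.
- by rewrite (pi_plusE (principal_wordY i s)) QE !linear0; apply: in_span0.
by rewrite PE QE !linearP -PE -QE; apply: in_span_lin.
Qed.

End Grading.
(** * The cocycle identity *)

Section TraceCocycle.
Context {F : numFieldType} {L : lieSuperType F} (P Q : {linear L -> L}).
Context (PQ : forall x, P x + Q x = x).
Context (sigmaP : forall x, sigma (P x) = P (sigma x)).
Context (sigmaQ : forall x, sigma (Q x) = Q (sigma x)).
Context (QP_rank : forall y, finite_rank (fun z => Q (sbracket y (P z)))).
Implicit Types (x y z : L) (a b c : bool) (E : {linear L -> L}).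

Definition tau x y : F := supertrace (fun v => sbracket x (Q (sbracket y (P v)))).

Definition tau3 E x y z : F :=
  supertrace (fun v => sbracket x (E (sbracket y (Q (sbracket z (P v)))))).

Lemma tau_rank x y : finite_rank (fun v => sbracket x (Q (sbracket y (P v)))).
Proof. exact: (finite_rank_compl (sbracket x) (QP_rank y)). Qed.

Lemma tau3_rank E x y z :
  finite_rank (fun v => sbracket x (E (sbracket y (Q (sbracket z (P v)))))).
Proof. exact: (finite_rank_compl (sbracket x \o E \o sbracket y) (QP_rank z)). Qed.

Lemma tau_linl (t : F) x x' y : tau (t *: x + x') y = t * tau x y + tau x' y.
Proof.
rewrite /tau -supertrace_lin; try exact: tau_rank.
by congr supertrace; apply: funext => v; rewrite sbracketPl.
Qed.

Lemma tau_linr (t : F) x y y' : tau x (t *: y + y') = t * tau x y + tau x y'.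
Proof.
rewrite /tau -supertrace_lin; try exact: tau_rank.
congr supertrace; apply: funext => v.
by rewrite sbracketPl (linearP Q) (linearP (sbracket x)).
Qed.

Lemma tau_odd a b x y : has_parity a x -> has_parity b y -> a (+) b -> tau x y = 0.
Proof.
move=> xa yb ab; apply: supertrace_odd => [|v]; first exact: tau_rank.
rewrite (sigma_bracket _ xa) sigmaQ (sigma_bracket _ yb) sigmaP linearZ linearZ /=.
rewrite scalerA -signr_addb ab expr1 scaleN1r //.
Qed.

Lemma tau_weight d (r s : F) x y : has_parity false d -> r + s != 0 ->
  (forall v, sbracket d (P v) = P (sbracket d v)) ->
  (forall v, sbracket d (Q v) = Q (sbracket d v)) ->
  sbracket d x = r *: x -> sbracket d y = s *: y -> tau x y = 0.
Proof.
move=> d0 rs dP dQ dx dy.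
apply: (supertrace_weight (D := sbracket d) rs) => [|v|v]; first exact: tau_rank.
  by rewrite (sigma_bracket _ d0) expr0 scale1r.
rewrite /= (sbracket_even _ _ d0) dx dQ (sbracket_even _ _ d0) dy dP.
by rewrite !(linearD, sbracketZl, linearZ) /= addrA -scalerDl.
Qed.

(* The cocycle identity follows by inserting [P + Q = 1] between [x] and [y] in
   [tau [x, y] z] and in [tau z [x, y]]: the resulting terms are of the form
   [tau3], up to a cyclic rotation, and cancel in pairs. *)
Lemma tau_bracketl a b x y z : has_parity a x -> has_parity b y ->
  tau (sbracket x y) z = tau3 P x y z + tau3 Q x y z
    - (-1) ^+ (a && b) * (tau3 P y x z + tau3 Q y x z).
Proof.
move=> xa yb; rewrite -!supertraceD; try exact: tau3_rank.
rewrite -mulNr addrC -supertrace_lin; last 2 first.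
- by apply: finite_rankD; apply: tau3_rank.
- by apply: finite_rankD; apply: tau3_rank.
congr supertrace; apply: funext => v.
rewrite (sbracketA _ xa yb) -!(linearD (sbracket _)) !PQ.
by rewrite scaleNr addrC.
Qed.

(** The factor (ad y) P, of parity b, is carried from the right end to the left end. What remains
    still contains [Q (sbracket x (P v))], hence has finite rank. *)
Lemma tau3_rot b x y z : has_parity b y ->
  supertrace (fun v => sbracket z (Q (sbracket x (P (sbracket y (P v)))))) =
    (-1) ^+ b * tau3 P y z x.
Proof.
move=> yb; rewrite /tau3.
rewrite (@supertraceC _ _ b (sbracket y \o P) (fun v => sbracket z (Q (sbracket x (P v))))).
- by rewrite mulrA -signr_addb addbb mul1r.
- by move=> v /=; rewrite (sigma_bracket _ yb) sigmaP.
exact: tau_rank.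
Qed.

Lemma tau_bracketr a b x y z : has_parity a x -> has_parity b y ->
  tau z (sbracket x y) = (-1) ^+ b * tau3 P y z x + tau3 Q z x y
    - (-1) ^+ (a && b) * ((-1) ^+ a * tau3 P x z y + tau3 Q z y x).
Proof.
move=> xa yb; rewrite -(tau3_rot _ _ yb) -(tau3_rot _ _ xa).
have rk x' y' : finite_rank
    (fun v => sbracket z (Q (sbracket x' (P (sbracket y' (P v)))))).
  exact: (finite_rank_compr (sbracket y' \o P) (tau_rank z x')).
rewrite -!supertraceD; try by [apply: tau3_rank | apply: rk].
rewrite -mulNr addrC -supertrace_lin; last 2 first.
- by apply: finite_rankD; [apply: rk | apply: tau3_rank].
- by apply: finite_rankD; [apply: rk | apply: tau3_rank].
congr supertrace; apply: funext => v.
rewrite -!(linearD (sbracket z)) -!(linearD Q) -!(linearD (sbracket _)) !PQ.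
rewrite (sbracketA _ xa yb) addrC -scaleNr (linearP Q) (linearP (sbracket z)).
by [].
Qed.

Definition trace_form a b x y : F :=
  2^-1 * tau x y - 2^-1 * (-1) ^+ (a && b) * tau y x.

Lemma trace_form_odd a b x y :
  has_parity a x -> has_parity b y -> a (+) b -> trace_form a b x y = 0.
Proof.
move=> xa yb ab; rewrite /trace_form (tau_odd xa yb ab) (tau_odd yb xa) 1?addbC //.
by rewrite !mulr0 subr0.
Qed.

Lemma trace_form_cocycle a b c x y z :
  has_parity a x -> has_parity b y -> has_parity c z ->
  trace_form (a (+) b) c (sbracket x y) z =
    trace_form a (b (+) c) x (sbracket y z)
    - (-1) ^+ (a && b) * trace_form b (a (+) c) y (sbracket x z).
Proof.
move=> xa yb zc.
have xy := sbracket_parity xa yb; have yz := sbracket_parity yb zc.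
have xz := sbracket_parity xa zc.
have [odd_xyz|] := boolP (a (+) b (+) c).
  rewrite (trace_form_odd xy zc odd_xyz) (trace_form_odd xa yz) ?addbA //.
  by rewrite (trace_form_odd yb xz) ?mulr0 ?subr0 // addbCA addbA.
rewrite /trace_form (tau_bracketl _ xa yb) (tau_bracketr _ xa yb).
rewrite (tau_bracketl _ yb zc) (tau_bracketr _ yb zc).
rewrite (tau_bracketl _ xa zc) (tau_bracketr _ xa zc).
(* Only the four parity cases with even sum remain; in each, the signs of the rotated terms become
   explicit and the [tau3] terms cancel. *)
by case: a b c {xa yb zc xy yz xz} => [] [] [] //= _; ring.
Qed.

End TraceCocycle.
(** * Comparison with the Weyl vector *)

Section KacPeterson.
Context {F : numFieldType} {n : nat} {h : vectType F} {L : lieSuperType F}.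
Context (S : generators h n L).
Context {p : 'I_n -> bool} {alpha : 'I_n -> 'Hom(h, F^o)} {hv : 'I_n -> h}.
Context (rel : relations p alpha hv S) (tot : forall x, spanned S x).
Context (v0 : h) (v0E : forall i, alpha i v0 = 1).
Context (cartan_inj : forall v, cartan S v = 0 -> v = 0).
Implicit Types (x y z : L) (a b c : bool) (rho : 'Hom(h, F^o)).

(** * Extension of functionals by zero on the root spaces *)

Lemma root_vectorsZ (t : F) x : root_vectors S x -> root_vectors S (t *: x).
Proof.
move=> [beta b0 xE]; exists beta => // v.
by rewrite linearZ /= xE !scalerA mulrC.
Qed.

Lemma root_sum_lin (t : F) x y : sums_of (root_vectors S) x ->
  sums_of (root_vectors S) y -> sums_of (root_vectors S) (t *: x + y).
Proof. by apply: sums_of_lin; apply: root_vectorsZ. Qed.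

Lemma root_sum_adcartan v x : sums_of (root_vectors S) x ->
  sums_of (root_vectors S) (sbracket (cartan S v) x).
Proof.
apply: sums_of_map => z [beta b0 zE] /=; rewrite zE; apply: root_vectorsZ.
by exists beta.
Qed.

Lemma root_sum_parpr a x : sums_of (root_vectors S) x ->
  sums_of (root_vectors S) (parpr a x).
Proof.
apply: sums_of_map => z [beta b0 zE] /=; exists beta => // v.
by rewrite -parpr_bracket_even ?zE ?linearZ //; apply: (cartan_parity rel).
Qed.

(** If the first summand has root beta and beta(v) is nonzero, then ad v - beta(v) removes this
    summand, while it multiplies the invariant vector [x] by - beta(v); induction on the number of
    summands concludes. *)
Lemma root_sum_eq0 x : (forall v, sbracket (cartan S v) x = 0) ->
  sums_of (root_vectors S) x -> x = 0.
Proof.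
move=> x0 [s]; move: {2}(size s) (erefl (size s)) => m.
elim: m s x x0 => [|m IHm] [|y s] x x0 //= => [_ _ ->|]; first by rewrite big_nil.
move=> [sz] sP xE; have [beta b0 yE] := sP y (mem_head _ _).
have [v bv] : exists v, beta v != 0.
  apply: contrapT => nb; case/eqP: b0; apply/lfunP => v; rewrite lfunE /=.
  by apply: contrapT => /eqP bv; apply: nb; exists v.
have xbv : - (beta v : F) *: x =
    \sum_(z <- [seq sbracket (cartan S v) z - (beta v : F) *: z | z <- s]) z.
  rewrite -[LHS]addr0 -[X in _ + X = _](x0 v) [in LHS]xE big_cons big_map.
  rewrite (linearD (sbracket _)) /= yE (linear_sum (sbracket _)) /=.
  by rewrite sumrB -scaler_sumr addrC scaleNr scalerDr opprD addrACA subrr add0r.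
have : - (beta v : F) *: x = 0.
  apply: (IHm _ _ _ _ _ xbv) => [u||_ /mapP[z zs ->]].
  - by rewrite linearZ /= x0 scaler0.
  - by rewrite size_map.
  have [|gamma g0 zE] := sP z; first by rewrite inE zs orbT.
  by rewrite zE -scalerBl; apply: root_vectorsZ; exists gamma.
by move/eqP; rewrite scaler_eq0 oppr_eq0 (negPf bv) => /eqP.
Qed.

(** Two candidates for the chosen Cartan component differ by an element of h that is a sum of root
    vectors; h kills it, so it is 0 by [root_sum_eq0]. *)
Lemma extend_by_zeroE rho v x : sums_of (root_vectors S) x ->
  extend_by_zero S rho (cartan S v + x) = rho v.
Proof.
move=> xr; congr (rho _); apply: xget_unique => [|w].
  by rewrite /= addrAC subrr add0r.
rewrite /= => xwr; apply/eqP; rewrite -subr_eq0; apply/eqP; apply: cartan_inj.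
apply: root_sum_eq0 => [u|]; first exact: (cartan_cartan rel).
have := root_sum_lin (-1) xwr xr.
by rewrite scaleN1r opprB opprD addrA subrK (linearB (cartan S)).
Qed.

Lemma weight_const (beta : 'I_n -> 'Hom(h, F^o)) (t : F) i s :
  (forall j, beta j v0 = t) -> weight beta i s v0 = t *+ (size s).+1.
Proof.
move=> bt; elim: s => [|j s IHs]; first by rewrite /weight big_seq1 bt.
by rewrite weight_cons add_lfunE IHs bt [size _]/= [in RHS]mulrS.
Qed.

(** A word is a root vector: its weight takes at [v0] the value plus or minus its length, which is
    nonzero in characteristic 0. *)
Lemma cartan_root_decomposition x :
  exists v y, sums_of (root_vectors S) y /\ x = cartan S v + y.
Proof.
elim: (tot x) => [v|i s|i s|a y z _ [v [y' [yr ->]]] _ [w [z' [zr ->]]]].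
- by exists v, 0; rewrite addr0; split=> //; apply: sums_of0.
- exists 0, (word (genX S) i s); rewrite linear0 add0r; split=> //.
  apply: sums_of_sub; exists (weight alpha i s) => [|v]; last exact: (cartan_word rel).
  apply: contraTneq (oner_neq0 F) => /(congr1 (fun f : 'Hom(h, F^o) => f v0)).
  rewrite (weight_const _ _ v0E) zero_lfunE => /eqP.
  by rewrite pnatr_eq0.
- exists 0, (word (genY S) i s); rewrite linear0 add0r; split=> //.
  apply: sums_of_sub; exists (weight (fun i => - alpha i) i s) => [|v]; last first.
    exact: (cartan_word (swap_relations rel)).
  apply: contraTneq (oner_neq0 F) => /(congr1 (fun f : 'Hom(h, F^o) => f v0)).
  rewrite (weight_const (t := -1)) => [|j]; last by rewrite opp_lfunE v0E.
  by rewrite zero_lfunE mulNrn => /eqP; rewrite oppr_eq0 pnatr_eq0.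
exists (a *: v + w), (a *: y' + z'); split; first exact: root_sum_lin.
by rewrite linearP scalerDr addrACA.
Qed.

Lemma extend_by_zero_scalar rho : scalar (extend_by_zero S rho).
Proof.
move=> a x y; have [v [x' [xr ->]]] := cartan_root_decomposition x.
have [w [y' [yr ->]]] := cartan_root_decomposition y.
rewrite scalerDr addrACA -linearP !extend_by_zeroE ?linearP //.
exact: root_sum_lin.
Qed.

Lemma extend_by_zero_root rho x :
  sums_of (root_vectors S) x -> extend_by_zero S rho x = 0.
Proof.
move=> xr; have := extend_by_zeroE rho 0 xr.
by rewrite linear0 add0r linear0.
Qed.

Lemma extend_by_zero_degree rho k x :
  k != 0 -> principal S k x -> extend_by_zero S rho x = 0.
Proof.
move=> k0 kx; have [v [y [yr xE]]] := cartan_root_decomposition x.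
apply: extend_by_zero_root; have kF : k%:~R != 0 :> F by rewrite intr_eq0.
(* In degree k, x is k^-1 [v0, x], and ad v0 kills the Cartan component of [x]. *)
rewrite -[x]scale1r -(mulVf kF) -scalerA -(principal_deg rel v0E kx).
rewrite xE linearD /= (cartan_cartan rel) add0r -[_ *: _]addr0.
by apply: root_sum_lin; [apply: root_sum_adcartan | apply: sums_of0].
Qed.

Lemma extend_by_zero_odd rho x : has_parity true x -> extend_by_zero S rho x = 0.
Proof.
move=> x1; have [v [y [yr xE]]] := cartan_root_decomposition x.
apply: extend_by_zero_root; rewrite -x1 xE linearD /=.
by rewrite (parprE _ (cartan_parity rel v)) add0r; apply: root_sum_parpr.
Qed.

(** * Agreement of the two cocycles *)

Section Comparison.
Context (rho : 'Hom(h, F^o)) (P Q : {linear L -> L}).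
Context (PE : pi_plus S = P) (QE : pi_minus S = Q).
Context (rhoE : weyl_vector alpha hv rho) (hv_neq0 : forall i, hv i != 0).

Local Notation eps := (extend_by_zero S rho).

Let QP_rank y : finite_rank (fun z => Q (sbracket y (P z))).
Proof. by rewrite -PE -QE; exact: (pi_ad_pi_finite_rank rel tot v0E). Qed.

(** Such a [y] maps g_+ into itself, so pi_- ad_y pi_+ is already 0. *)
Lemma tau_nonneg l x y : 0 <= l -> principal S l y -> tau P Q x y = 0.
Proof.
move=> l0 ly; apply: supertrace0 => z.
have -> : Q (sbracket y (P z)) = 0; last by rewrite linear0.
apply: (homogeneous_eq rel tot (f := Q \o sbracket y \o P) (g := \0)) => k a {}z kz _ /=.
rewrite -PE -QE (pi_plusE rel v0E kz); case: ifP => k0.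
  by rewrite (pi_minusE rel v0E (principal_bracket ly kz)) ltr_wpDl.
by rewrite QE !linear0.
Qed.

Lemma tau_degree k l x y : principal S k x -> principal S l y -> k + l != 0 ->
  tau P Q x y = 0.
Proof.
move=> kx ly kl; apply: (tau_weight QP_rank (cartan_parity rel v0) _ _ _
  (principal_deg rel v0E kx) (principal_deg rel v0E ly)).
- by rewrite -intrD intr_eq0.
- by move=> v; rewrite -PE; exact: (adv0_pi_plus rel tot v0E).
by move=> v; rewrite -QE; exact: (adv0_pi_minus rel tot v0E).
Qed.

Lemma psiKP_homE a b x y : psiKP_hom S a b x y = trace_form P Q a b x y.
Proof. by rewrite /psiKP_hom PE QE. Qed.

Lemma trace_form_linl a b (t : F) x x' y :
  trace_form P Q a b (t *: x + x') y =
    t * trace_form P Q a b x y + trace_form P Q a b x' y.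
Proof. by rewrite /trace_form (tau_linl QP_rank) (tau_linr QP_rank); ring. Qed.

Lemma trace_form_linr a b (t : F) x y y' :
  trace_form P Q a b x (t *: y + y') =
    t * trace_form P Q a b x y + trace_form P Q a b x y'.
Proof. by rewrite /trace_form (tau_linl QP_rank) (tau_linr QP_rank); ring. Qed.

Lemma trace_form0l a b y : trace_form P Q a b 0 y = 0.
Proof.
by have := trace_form_linl a b (-1) 0 0 y; rewrite scaler0 addr0 mulN1r addNr.
Qed.

Lemma trace_form0r a b x : trace_form P Q a b x 0 = 0.
Proof.
by have := trace_form_linr a b (-1) x 0 0; rewrite scaler0 addr0 mulN1r addNr.
Qed.

Lemma psiKP_linl (t : F) x x' y :
  psiKP S (t *: x + x') y = t * psiKP S x y + psiKP S x' y.
Proof.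
rewrite /psiKP !big_bool /= !psiKP_homE !linearP !trace_form_linl; ring.
Qed.

Lemma psiKP_linr (t : F) x y y' :
  psiKP S x (t *: y + y') = t * psiKP S x y + psiKP S x y'.
Proof.
rewrite /psiKP !big_bool /= !psiKP_homE !linearP !trace_form_linr; ring.
Qed.

Lemma psiKPE a b x y : has_parity a x -> has_parity b y ->
  psiKP S x y = trace_form P Q a b x y.
Proof.
move=> xa yb; rewrite /psiKP !big_bool /= !psiKP_homE.
rewrite !(parprE _ xa) !(parprE _ yb).
by case: a b {xa yb} => [] [] /=; rewrite ?trace_form0l ?trace_form0r ?add0r ?addr0.
Qed.

Lemma psiKP_degree k l a b x y : principal S k x -> principal S l y ->
  has_parity a x -> has_parity b y -> k + l != 0 ->
  psiKP S x y = eps (sbracket x y).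
Proof.
move=> kx ly xa yb kl; rewrite (psiKPE xa yb) /trace_form.
rewrite (extend_by_zero_degree _ kl (principal_bracket kx ly)).
by rewrite (tau_degree kx ly kl) (tau_degree ly kx _) ?(addrC l) // !mulr0 subr0.
Qed.

Lemma psiKP_skew a b x y : has_parity a x -> has_parity b y ->
  psiKP S x y = eps (sbracket x y) -> psiKP S y x = eps (sbracket y x).
Proof.
have [eps' epsE] := scalar_bundle (extend_by_zero_scalar rho).
move=> xa yb; rewrite (psiKPE xa yb) (psiKPE yb xa) (sbracket_skew yb xa).
rewrite epsE linearN linearZ => <-; rewrite /trace_form [b && a]andbC.
by case: (a && b); rewrite /= ?expr1 ?expr0; ring.
Qed.

Lemma genX_neq0 i : genX S i != 0.
Proof.
apply: contra_neq (hv_neq0 i) => Xi0; apply: cartan_inj.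
by have := genX_genY rel i i; rewrite eqxx Xi0 sbracket0l.
Qed.

(** Words of length at least 2 stay in positive degree under Y_j and are killed by pi_-. Only X_j
    survives: [Y_j, X_j] = - (-1)^p(j) h_j lies in degree 0, thus in g_-, and X_i sends it to
    (-1)^p(j) alpha_i(h_j) X_i. The sign cancels against that of the supertrace. *)
Lemma tau_genX_genY i j :
  tau P Q (genX S i) (genY S j) = if i == j then alpha i (hv i) : F else 0.
Proof.
pose f := [the {linear L -> L} of
  sbracket (genX S i) \o Q \o sbracket (genY S j) \o P].
have fX k : f (genX S k) =
    if k == j then ((-1) ^+ p j * (alpha i (hv j) : F)) *: genX S i else 0.
  rewrite /f /= -PE (pi_plusE rel v0E (principal_X S k)) ltr01.
  rewrite (sbracket_skew (genY_parity rel j) (genX_parity rel k)) (genX_genY rel).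
  case: eqP => [->|_]; last by rewrite scaler0 oppr0 !linear0.
  rewrite andbb linearN linearN linearZ linearZ /=.
  rewrite -QE (pi_minusE rel v0E (principal_cartan S _)) (genX_cartan rel).
  by rewrite scaleNr scalerN opprK scalerA.
(* The image lies in the line of X_i; as X_i is nonzero, the coordinate [c] is unique, hence linear,
   and gives a decomposition with a single term. *)
have /choice[c fE] x : exists t : F, f x = t *: genX S i.
  elim: (tot x) => [v|k s|k s|a y z _ [r yE] _ [t zE]].
  - exists 0; rewrite /f /= -PE (pi_plusE rel v0E (principal_cartan S v)).
    by rewrite !linear0 scale0r.
  - case: s => [|l s].
      rewrite [word _ _ _]/= fX; case: ifP => _; first by eexists.
      by exists 0; rewrite scale0r.
    exists 0; rewrite /f /= -PE (pi_plusE rel v0E (principal_wordX S k (l :: s))).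
    have := principal_bracket (principal_Y S j) (principal_wordX S k (l :: s)).
    by rewrite -QE => /(pi_minusE rel v0E) /= ->; rewrite linear0 scale0r.
  - exists 0; rewrite /f /= -PE (pi_plusE rel v0E (principal_wordY S k s)).
    by rewrite !linear0 scale0r.
  by exists (a * r + t); rewrite linearP yE zE scalerA scalerDl.
have cE x t : f x = t *: genX S i -> c x = t.
  by rewrite fE => /eqP; rewrite -subr_eq0 -scalerBl scaler_eq0 (negPf (genX_neq0 i))
    orbF subr_eq0 => /eqP.
have lc : scalar c.
  by move=> a x y; apply: cE; rewrite linearP !fE scalerDl scalerA.
rewrite /tau -[X in supertrace X]/(f : L -> L).
rewrite (@supertraceE _ _ f 1 (fun=> c) (fun=> genX S i)) => [|//|x]; last first.
  by rewrite big_ord1 fE.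
have [c' c'E] := scalar_bundle lc.
rewrite big_ord1 (sigmaE (genX_parity rel i)) c'E linearZ -c'E /=.
case: eqP fX => [<-|/eqP ij] fX.
  move: (fX i); rewrite eqxx => /cE->.
  by rewrite mulrA -signr_addb addbb mul1r.
have /cE-> : f (genX S i) = 0 *: genX S i by rewrite fX (negPf ij) scale0r.
by rewrite mulr0.
Qed.

(** The trace in the opposite order vanishes because X_i has positive degree; the other one
    contributes alpha_i(h_i)/2, which is rho(h_i). *)
Lemma psiKP_genX_genY i j :
  psiKP S (genX S i) (genY S j) = eps (sbracket (genX S i) (genY S j)).
Proof.
have [eps' epsE] := scalar_bundle (extend_by_zero_scalar rho).
rewrite (psiKPE (genX_parity rel i) (genY_parity rel j)) /trace_form tau_genX_genY.
rewrite (tau_nonneg (l := 1)) //; last exact: principal_X.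
rewrite (genX_genY rel) mulr0 subr0; case: eqP => [->|_].
  rewrite -[cartan S _]addr0 extend_by_zeroE; last exact: sums_of0.
  by rewrite rhoE.
by rewrite mulr0 epsE linear0.
Qed.

Lemma spanned_parity_ind (K : L -> Prop) :
  (forall (a : F) x y, K x -> K y -> K (a *: x + y)) ->
  (forall v, K (cartan S v)) ->
  (forall i s a, has_parity a (word (genX S) i s) -> K (word (genX S) i s)) ->
  (forall i s a, has_parity a (word (genY S) i s) -> K (word (genY S) i s)) ->
  forall x, K x.
Proof.
move=> Klin Kc KX KY x; elim: (tot x) => [v|i s|i s|a y z _ Ky _ Kz] //.
- by have [a wa] := word_parity i s (genX_parity rel); apply: KX wa.
- by have [a wa] := word_parity i s (genY_parity rel); apply: KY wa.
exact: Klin.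
Qed.

(** Induction on the length. The cocycle identity expresses the value at ([G_j, w], z) through those
    at (G_j, [w, z]) and (w, [G_j, z]); for the coboundary the same identity is the Jacobi
    identity. *)
Lemma psiKP_word (G : 'I_n -> L) i s :
  (forall j, has_parity (p j) (G j)) ->
  (forall j z, psiKP S (G j) z = eps (sbracket (G j) z)) ->
  forall z, psiKP S (word G i s) z = eps (sbracket (word G i s) z).
Proof.
have [eps' epsE] := scalar_bundle (extend_by_zero_scalar rho).
move=> Gp Gpsi; elim: s => [|j s IHs] //= z.
have [a wa] := word_parity i s Gp.
move: z; apply: (homogeneous_ind rel tot) => [t x y xE yE|k c z _ zc].
  by rewrite psiKP_linr xE yE linearP epsE linearP.
rewrite (psiKPE (sbracket_parity (Gp j) wa) zc).
rewrite (trace_form_cocycle _ _ _ QP_rank (Gp j) wa zc).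
- rewrite -(psiKPE (Gp j) (sbracket_parity wa zc)).
  rewrite -(psiKPE wa (sbracket_parity (Gp j) zc)) IHs Gpsi.
  by rewrite (sbracketA _ (Gp j) wa) epsE linearB linearZ.
- by move=> x; rewrite -PE -QE; apply: (pi_sum rel tot v0E).
- by move=> x; rewrite -PE; apply: (sigma_pi_plus rel tot v0E).
by move=> x; rewrite -QE; apply: (sigma_pi_minus rel tot v0E).
Qed.

Lemma psiKP_extend_by_zero x y : psiKP S x y = eps (sbracket x y).
Proof.
have [eps' epsE] := scalar_bundle (extend_by_zero_scalar rho).
have linr u (a : F) z w : psiKP S u z = eps (sbracket u z) ->
    psiKP S u w = eps (sbracket u w) ->
    psiKP S u (a *: z + w) = eps (sbracket u (a *: z + w)).
  by move=> uz uw; rewrite psiKP_linr uz uw linearP epsE linearP.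
move: x y; apply: spanned_parity_ind => [a x y xE yE z|v|i s a _|i s a _].
- by rewrite psiKP_linl xE yE sbracketPl epsE linearP.
- apply: spanned_parity_ind => [a z w|u|i s a wa|i s a wa]; first exact: linr.
  (* Two Cartan elements have opposite degrees, so the degree argument is silent here; both traces
     vanish because h preserves g_+. *)
  + rewrite (psiKPE (cartan_parity rel v) (cartan_parity rel u)) (cartan_cartan rel).
    rewrite /trace_form (tau_nonneg _ (lexx 0) (principal_cartan S u)).
    rewrite (tau_nonneg _ (lexx 0) (principal_cartan S v)).
    by rewrite !mulr0 subr0 epsE linear0.
  + apply: (psiKP_degree (principal_cartan S v) (principal_wordX S i s)
      (cartan_parity rel v) wa _); by rewrite add0r.
  apply: (psiKP_degree (principal_cartan S v) (principal_wordY S i s)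
      (cartan_parity rel v) wa _); by rewrite add0r oppr_eq0.
- apply: (psiKP_word i s (genX_parity rel) _) => j.
  apply: spanned_parity_ind => [b z w|u|k t b wb|k [|l t] b wb]; first exact: linr.
  + exact: (psiKP_degree (principal_X S j) (principal_cartan S u)
      (genX_parity rel j) (cartan_parity rel u) _).
  + exact: (psiKP_degree (principal_X S j) (principal_wordX S k t)
      (genX_parity rel j) wb _).
  + exact: psiKP_genX_genY.
  exact: (psiKP_degree (principal_X S j) (principal_wordY S k (l :: t))
      (genX_parity rel j) wb _).
apply: (psiKP_word i s (genY_parity rel) _) => j.
apply: spanned_parity_ind => [b z w|u|k [|l t] b wb|k t b wb]; first exact: linr.
+ exact: (psiKP_degree (principal_Y S j) (principal_cartan S u)
    (genY_parity rel j) (cartan_parity rel u) _).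
+ apply: (psiKP_skew (genX_parity rel k) (genY_parity rel j) _).
  exact: psiKP_genX_genY.
+ exact: (psiKP_degree (principal_Y S j) (principal_wordX S k (l :: t))
    (genY_parity rel j) wb _).
exact: (psiKP_degree (principal_Y S j) (principal_wordY S k t)
    (genY_parity rel j) wb _).
Qed.

End Comparison.

Lemma psiKP_weyl rho : weyl_vector alpha hv rho -> (forall i, hv i != 0) ->
  forall x y, psiKP S x y = coboundary (extend_by_zero S rho) x y.
Proof.
have [P PE] := linear_bundle (pi_plus_linear rel tot v0E).
have [Q QE] := linear_bundle (pi_minus_linear rel tot v0E).
exact: (psiKP_extend_by_zero PE QE).
Qed.

End KacPeterson.

(** * Duality in the Cartan subalgebra *)

Section Realization.
Context {F : fieldType} {n : nat} {h : vectType F}.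
Implicit Types (alpha : 'I_n -> 'Hom(h, F^o)) (hv : 'I_n -> h).

Lemma free_prescribed (V : vectType F) (u : 'I_n -> V) (t : 'I_n -> F) :
  free [seq u i | i : 'I_n] -> exists f : {linear V -> F^o}, forall i, f (u i) = t i.
Proof.
move=> u_free; pose T := [seq (t i : F^o) | i : 'I_n].
have [f fE] := linear_of_free [seq u i | i : 'I_n] T.
exists f => i; have := fE u_free; rewrite !size_map => /(_ erefl).
by rewrite -map_comp => /eq_in_map; apply; rewrite mem_enum.
Qed.

(* A functional on the dual space is an evaluation. *)
Lemma exists_common_value alpha (t : 'I_n -> F) : free [seq alpha i | i : 'I_n] ->
  exists v, forall i, alpha i v = t i.
Proof.
move=> /free_prescribed-/(_ t)[f fE]; pose b := vbasis {:h}.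
pose e k : 'Hom(h, F^o) := linfun (coord b k : h -> F^o).
exists (\sum_(k < \dim {:h}) (f (e k) : F) *: b`_k) => i.
have alphaE : alpha i = \sum_(k < \dim {:h}) (alpha i b`_k : F) *: e k.
  apply/lfunP => v; rewrite [in LHS](coord_vbasis (memvf v)) linear_sum.
  rewrite sum_lfunE; apply: eq_bigr => k _.
  by rewrite scale_lfunE lfunE linearZ /= [LHS]mulrC.
rewrite -[RHS]fE [in RHS]alphaE !linear_sum; apply: eq_bigr => k _.
by rewrite !linearZ /= [LHS]mulrC.
Qed.

Lemma exists_weyl_vector alpha hv : free [seq hv i | i : 'I_n] ->
  exists rho, weyl_vector alpha hv rho.
Proof.
move=> /free_prescribed-/(_ (fun i => 2^-1 * (alpha i (hv i) : F)))[f fE].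
by exists (linfun f) => i; rewrite lfunE /= fE.
Qed.

End Realization.

(** * Contragredient superalgebras and the conclusion *)

Section Contragredient.
Context {F : numFieldType} {n : nat} {p : 'I_n -> bool} {h : vectType F}.
Context {alpha : 'I_n -> 'Hom(h, F^o)} {hv : 'I_n -> h}.
Context {L : lieSuperType F} {S : generators h n L}.

Lemma contragredient_relations : contragredient p alpha hv S -> relations p alpha hv S.
Proof.
move=> [Lb [Sb [q [[[[Hp Xp Yp] hX hY XY hh] _ _] [qp qb] [qH qX qY] _ _]]]].
split; [split | ..] => *; rewrite -?qH -?qX -?qY -?qb ?hX ?hY ?XY ?hh.
- by rewrite /has_parity -qp Hp.
- by rewrite /has_parity -qp Xp.
- by rewrite /has_parity -qp Yp.
- exact: linearZ_LR.
- by rewrite linearN linearZ.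
- by case: eqP; rewrite ?linear0.
exact: linear0.
Qed.

Lemma contragredient_generated : contragredient p alpha hv S ->
  forall W : {pred L}, subsuperalgebra W -> gens_in S W -> forall x, x \in W.
Proof.
move=> [Lb [Sb [q [[_ gen _] [qp qb] [qH qX qY] q_surj _]]]].
move=> W [[[W0 Wlin] Wpar] Wbr] [WH WX WY] x; have [y <-] := q_surj x.
have /(_ _ _ y) := gen [pred z | q z \in W]; apply.
  split; [split; [split|]|].
  - by rewrite inE linear0.
  - by move=> a u v; rewrite !inE linearP; apply: Wlin.
  - by move=> a u; rewrite !inE qp; apply: Wpar.
  by move=> u v; rewrite !inE qb; apply: Wbr.
by split=> *; rewrite inE ?qH ?qX ?qY.
Qed.

(** The kernel of the quotient map is an ideal meeting the Cartan subalgebra trivially. *)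
Lemma contragredient_cartan_inj : contragredient p alpha hv S ->
  forall v, cartan S v = 0 -> v = 0.
Proof.
move=> [Lb [Sb [q [_ _ [qH _ _] _ [_ J0 _]]]]] v v0.
by apply: J0; rewrite inE qH v0.
Qed.

End Contragredient.

Theorem proposition77 (R : realType) (n : nat) (A : 'M[R[i]]_n)
    (p : 'I_n -> bool) (h : vectType R[i]) (alpha : 'I_n -> 'Hom(h, R[i]^o))
    (hv : 'I_n -> h) (g : lieSuperType R[i]) (S : generators h n g)
    (d : 'I_n -> R[i]) (B : g -> g -> R[i]) :
  kac_moody A p alpha hv S ->
  symmetrizes A d ->
  standard_form alpha hv S d B ->
  (forall rho : 'Hom(h, R[i]^o), weyl_vector alpha hv rho ->
     forall x y : g, psiKP S x y = coboundary (extend_by_zero S rho) x y) /\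
  KP_class_trivial S.
Proof.
move=> [[_ [_ alpha_free hv_free _] gA] _] _ _.
have rel := contragredient_relations gA.
have tot := spanned_total rel (contragredient_generated gA).
have inj := contragredient_cartan_inj gA.
have [v0 v0E] := exists_common_value (fun=> 1) alpha_free.
(* This makes X_i nonzero, as h_i = [X_i, Y_i]. *)
have hv_neq0 i : hv i != 0.
  by apply: (free_not0 hv_free); apply: map_f; rewrite mem_enum.
have psiE rho : weyl_vector alpha hv rho ->
    forall x y, psiKP S x y = coboundary (extend_by_zero S rho) x y.
  by move=> rhoE; apply: (psiKP_weyl rel tot v0E inj rhoE hv_neq0).
split=> //; have [rho rhoE] := exists_weyl_vector alpha hv_free.
exists (extend_by_zero S rho); split; last exact: psiE.
- split; first exact: (extend_by_zero_scalar rel tot v0E inj).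
  (* The bound is 0 since the functional vanishes in every nonzero degree. *)
  exists 0 => k x; rewrite normr_gt0 => k0 kx.
  exact: (extend_by_zero_degree rel tot v0E inj rho k0 kx).
- exact: (extend_by_zero_odd rel tot v0E inj).
move=> k x; exact: (extend_by_zero_degree rel tot v0E inj).
Qed.
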